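(* Let $\alpha\in(1,2)$, let $(S_\alpha(t))_{t\ge0}$ be an $\alpha$-stable process such that $X_T/a_T\xrightarrow{d}S_\alpha(1)$ as $T\to\infty$ for some Lévy process $X$ with $\mathbb{E}[X_1]=0$ and some positive function $a_T=T^{1/\alpha}l(T)$ with $l$ slowly varying at infinity. Let $(\ell_n)_{n\in\mathbb{N}}$ be a uniform stick-breaking process on $[0,1]$ independent of a sequence $(S_\alpha^{(n)})_{n\in\mathbb{N}}$ of independent copies of $S_\alpha(1)$. Then $$\lim_{x\to\infty}\frac{\mathbb{P}\big(\frac12\sum_{n=1}^\infty\ell_n^{2/\alpha-1}(S_\alpha^{(n)})^2>x\big)}{\mathbb{P}\big((S_\alpha^{(1)})^2>x\big)}=\lim_{x\to\infty}\frac{\mathbb{P}\big(\frac12\sum_{n=1}^\infty\ell_n^{2/\alpha-1}(S_\alpha^{(n)})^2>x\big)}{(c_++c_-)x^{-\alpha/2}}=\frac{2^{1-\alpha/2}}{2-\alpha},$$ for the constants $c_+,c_-\ge0$ defined by $c_\pm:=\lim_{x\to\infty}\mathbb{P}(\pm S_\alpha^{(1)}>\sqrt x)/x^{-\alpha/2}$, which satisfy $c_++c_->0$.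
   Context: Stable laws and processes are understood to be non-degenerate. The uniform stick-breaking process $(\ell_n)_{n\in\mathbb{N}}$ on $[0,1]$ is defined from an i.i.d. sequence $(V_n)_{n\in\mathbb{N}}$ of $\mathrm{U}(0,1)$ variables by $L_0:=1$, $\ell_n:=V_nL_{n-1}$, $L_n:=L_{n-1}-\ell_n$ for $n\in\mathbb{N}=\{1,2,\ldots\}$. *)

(* Defs.v *)
From HB Require Import structures.
From mathcomp Require Import all_boot all_order all_algebra.
From mathcomp Require Import all_classical all_reals all_analysis.

Set Implicit Arguments.
Unset Strict Implicit.
Unset Printing Implicit Defensive.

Import Order.TTheory GRing.Theory Num.Theory.
Import numFieldNormedType.Exports.

Local Open Scope classical_set_scope.
Local Open Scope ring_scope.

(* Equality of laws is tested on Borel sets only: a [measure] is a function on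
   all sets, unconstrained outside the sigma-algebra. *)
Definition same_law (R : realType)
    d (T : measurableType d) (P : probability T R) (X : T -> R)
    d' (T' : measurableType d') (P' : probability T' R) (X' : T' -> R) : Prop :=
  forall B : set R, measurable B -> P (X @^-1` B) = P' (X' @^-1` B).

Definition mutually_independent (R : realType) d (T : measurableType d)
    (P : probability T R) (I : choiceType) (X : I -> T -> R) : Prop :=
  forall (s : seq I) (B : I -> set R),
    uniq s -> (forall i, measurable (B i)) ->
    P (\bigcap_(i in [set` s]) (X i @^-1` B i)) =
    (\prod_(i <- s) P (X i @^-1` B i))%E.

(* Independence of the sigma-algebras generated by two families, stated on the
   generating pi-systems of finite-dimensional cylinders. *)
Definition independent_families (R : realType) d (T : measurableType d)
    (P : probability T R) (I J : choiceType)
    (X : I -> T -> R) (Y : J -> T -> R) : Prop :=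
  forall (s : seq I) (t : seq J) (B : I -> set R) (C : J -> set R),
    (forall i, measurable (B i)) -> (forall j, measurable (C j)) ->
    let EX := \bigcap_(i in [set` s]) (X i @^-1` B i) in
    let EY := \bigcap_(j in [set` t]) (Y j @^-1` C j) in
    P (EX `&` EY) = (P EX * P EY)%E.

Definition cvg_in_distribution (R : realType) (I : Type) (F : set_system I)
    d (T : measurableType d) (P : probability T R) (Y : I -> T -> R)
    d' (T' : measurableType d') (P' : probability T' R) (Z : T' -> R) : Prop :=
  forall f : R -> R, continuous f -> (exists M, forall x, `|f x| <= M) ->
    ('E_P[f \o Y i] @[i --> F] --> 'E_P'[f \o Z])%E.

Definition cadlag (R : realType) (x : R -> R) : Prop :=
  (forall t, 0 <= t -> x u @[u --> t^'+] --> x t) /\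
  (forall t, 0 < t -> cvg (x u @[u --> t^'-])).

(* A process (X_t), t >= 0, is encoded as a family over all of [R]; its values
   at negative times are never used. *)
Definition levy_process (R : realType) d (T : measurableType d)
    (P : probability T R) (X : R -> {RV P >-> R}) : Prop :=
  [/\ {ae P, forall w, X 0 w = 0},
      (forall t : nat -> R, 0 <= t 0%N -> (forall i, t i <= t i.+1) ->
         mutually_independent P (fun i w => X (t i.+1) w - X (t i) w)),
      (forall s h, 0 <= s -> 0 <= h ->
         same_law P (fun w => X (s + h) w - X s w) P (X h)) &
      {ae P, forall w, cadlag (fun t => X t w)}].

(* [S] is stable with index [alpha] when the law mu of [S 1] is a stable law of
   that index: for each a > 0 the convolution power mu^a, which is the law of
   [S a], is that of a^(1/alpha) * S_1 + c for some real c (Sato, Levy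
   Processes and Infinitely Divisible Distributions, Section 13).
   Non-degeneracy is part of the definition. *)
Definition stable_process (R : realType) (alpha : R) d (T : measurableType d)
    (P : probability T R) (S : R -> {RV P >-> R}) : Prop :=
  [/\ levy_process S,
      (forall a, 0 < a -> exists c : R,
         same_law P (S a) P (fun w => a `^ alpha^-1 * S 1 w + c)) &
      ~ (exists c : R, {ae P, forall w, S 1 w = c})].

(* As in Bingham, Goldie and Teugels, [l] need only be given near infinity. *)
Definition slowly_varying (R : realType) (l : R -> R) : Prop :=
  (exists A : R, measurable_fun `[A, +oo[ l /\ forall x, A <= x -> 0 < l x) /\
  (forall c, 0 < c -> l (c * x) / l x @[x --> +oo] --> (1 : R)).

(* Indices are shifted by one with respect to V_1, V_2, ... and l_1, l_2, ...:
   [V n] is V_(n+1) and [stick_length V n] is l_(n+1) = V_(n+1) * L_n. *)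
Fixpoint stick_remaining (R : realType) (T : Type) (V : nat -> T -> R)
    (n : nat) (w : T) : R :=
  if n is m.+1 then stick_remaining V m w - V m w * stick_remaining V m w
  else 1.

Definition stick_length (R : realType) (T : Type) (V : nat -> T -> R)
    (n : nat) (w : T) : R := V n w * stick_remaining V n w.

Definition iid_uniform01 (R : realType) d (T : measurableType d)
    (P : probability T R) (V : nat -> {RV P >-> R}) : Prop :=
  mutually_independent P (fun n => V n : T -> R) /\
  forall n (B : set R), measurable B ->
    P (V n @^-1` B) = uniform_prob (@ltr01 R) B.

(* Main.v *)
Require Import Defs.
From HB Require Import structures.
From mathcomp Require Import all_boot all_order all_algebra.
From mathcomp Require Import all_classical all_reals all_analysis.
From mathcomp Require Import measurable_realfun.
From mathcomp Require Import ring lra.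

Set Implicit Arguments.
Unset Strict Implicit.
Unset Printing Implicit Defensive.

Import Order.TTheory GRing.Theory Num.Theory.
Import numFieldNormedType.Exports.

Local Open Scope classical_set_scope.
Local Open Scope ring_scope.

(* Centering the stable process makes it strictly stable at integer times, and
   for this walk W a single big jump among n steps already accounts for a large
   value of W n = n^(1/alpha) W 1 in law. This gives first P(W 1 > x) <= C x^-alpha,
   and then that the upper limit of x^alpha P(W 1 > x) is at most its lower limit.
   If both tail constants vanished, iterating the bound on W 2 would give tails
   of order x^(-2 alpha), hence a finite second moment, which scaling by
   2^(1/alpha) forces to be 0.

   The sum of w_n Z_n with Z_n = (S^(n))^2 and w_n = ell_n^(2/alpha - 1) <= 1 is
   then large essentially only because one term is, so that its tail is
   (c_+ + c_-) x^(-alpha/2) times the sum of the E[w_n^(alpha/2)] = E[ell_n^s],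
   s = 1 - alpha/2. By the stick-breaking recursion E[ell_n^s] = (1 + s)^-n for
   n >= 1, and these sum to 1/s = 2 / (2 - alpha). *)

(** * Real-valued probabilities and independent pairs *)

(** Neither a Levy measure nor a characteristic function enters: the tail constants come from
    independence and scaling alone, at integer times. Stability determines S_n only up to a
    centering c_n. For alpha > 1, 2^(1/alpha) < 2, and comparing two block decompositions then fixes
    c_n; removing a drift b n leaves a strictly stable walk, and the shift b of S_1 is invisible in
    the tail asymptotics. The range of alpha is felt in the second moment. The exponent 2 alpha must
    exceed 2 for the moment to be finite, 2^(1/alpha) <> 2 forces mean 0, and 2^(2/alpha) > 2
    contradicts E[(W 2)^2] = 2 E[(W 1)^2] unless the moment is 0. In the weighted sum the w_n are
    dependent. This does no harm: as w_n <= 1, two large terms force two large Z_n, which are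
    pairwise independent, and a single term involves only the independence of w_n and Z_n. The
    infinitely many remaining terms get thresholds that decrease geometrically in n, slowly enough
    for the geometric decay of E[w_n^(alpha/2)] to pay for them. *)

Definition pr (R : realType) d (T : measurableType d) (P : probability T R)
  (A : set T) : R := fine (P A).

Section pr_basics.
Context (R : realType) d (T : measurableType d) (P : probability T R).
Implicit Types A B : set T.

Lemma prE A : measurable A -> P A = (pr P A)%:E.
Proof. by move=> mA; rewrite /pr fineK// fin_num_measure. Qed.

Lemma pr_ge0 A : 0 <= pr P A.
Proof. by rewrite /pr fine_ge0. Qed.

Lemma pr_le1 A : measurable A -> pr P A <= 1.
Proof. by move=> mA; rewrite -lee_fin -prE// probability_le1. Qed.

Lemma pr_mono A B : measurable A -> measurable B -> A `<=` B ->
  pr P A <= pr P B.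
Proof. by move=> mA mB AB; rewrite -lee_fin -!prE// le_measure ?inE. Qed.

Lemma pr0 : pr P set0 = 0.
Proof. by rewrite /pr measure0. Qed.

Lemma prT : pr P setT = 1.
Proof. by rewrite /pr probability_setT. Qed.

Lemma prU_disj A B : measurable A -> measurable B -> A `&` B = set0 ->
  pr P (A `|` B) = pr P A + pr P B.
Proof.
move=> mA mB AB; apply: EFin_inj; rewrite -prE; last exact: measurableU.
by rewrite measureU// EFinD -!prE.
Qed.

Lemma prU A B : measurable A -> measurable B ->
  pr P (A `|` B) + pr P (A `&` B) = pr P A + pr P B.
Proof.
move=> mA mB.
have mAB : measurable (A `&` B) by exact: measurableI.
have mBA : measurable (B `\` A) by exact: measurableD.
have -> : A `|` B = A `|` (B `\` A) by rewrite setDE setUIr setUCr setIT.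
rewrite prU_disj//; last by rewrite setDE setICA setICr setI0.
rewrite -addrA; congr (_ + _); rewrite addrC -prU_disj//.
  by rewrite setIC setUIDK.
by apply/seteqP; split => x //= [[? ?] [? ?]].
Qed.

Lemma prU_le A B : measurable A -> measurable B ->
  pr P (A `|` B) <= pr P A + pr P B.
Proof. by move=> mA mB; rewrite -prU// lerDl pr_ge0. Qed.

Lemma pr_bigU_le (n : nat) (E : nat -> set T) : (forall i, measurable (E i)) ->
  pr P (\big[setU/set0]_(i < n) E i) <= \sum_(i < n) pr P (E i).
Proof.
move=> mE; elim: n => [|n IH]; first by rewrite !big_ord0 pr0.
rewrite !big_ord_recr/= (le_trans (prU_le _ _))//.
  by apply: bigsetU_measurable => i _.
by rewrite lerD2r.
Qed.

(** Second-order Bonferroni inequality with the number of pairs bounded crudely by n^2: in the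
    induction, the new event meets the union of the earlier ones with probability at most n e. *)
Lemma bonferroni (n : nat) (E : nat -> set T) (e : R) :
  0 <= e -> (forall i, measurable (E i)) ->
  (forall i j, (i < j < n)%N -> pr P (E i `&` E j) <= e) ->
  \sum_(i < n) pr P (E i) <= pr P (\big[setU/set0]_(i < n) E i) + n%:R ^+ 2 * e.
Proof.
move=> e0 mE; elim: n => [|n IH] eE.
  by rewrite !big_ord0 pr0 expr0n mul0r addr0.
have mU : measurable (\big[setU/set0]_(i < n) E i).
  by apply: bigsetU_measurable => i _.
rewrite !big_ord_recr/=.
have /IH {}IH : forall i j, (i < j < n)%N -> pr P (E i `&` E j) <= e.
  by move=> i j /andP[ij jn]; apply: eE; rewrite ij (ltn_trans jn).
have := prU mU (mE n).
have : pr P (\big[setU/set0]_(i < n) E i `&` E n) <= n%:R * e.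
  rewrite big_distrl/= (le_trans (@pr_bigU_le n (fun i => E i `&` E n) _))//.
    by move=> i; exact: measurableI.
  rewrite mulr_natl -[n in e *+ n]card_ord -sumr_const; apply: ler_sum => i _.
  by apply: eE; rewrite ltn_ord ltnSn.
have -> : n.+1%:R ^+ 2 * e = n%:R ^+ 2 * e + n%:R * e + n%:R * e + e.
  by rewrite -natr1; ring.
have : 0 <= n%:R * e by rewrite mulr_ge0.
lra.
Qed.

End pr_basics.

Section indep2_law.
Context (R : realType).

Definition indep2 d (T : measurableType d) (P : probability T R)
  (X Y : T -> R) := forall B C, measurable B -> measurable C ->
  P (X @^-1` B `&` Y @^-1` C) = (P (X @^-1` B) * P (Y @^-1` C))%E.

Lemma measurable_gt_set d (T : measurableType d) (X : T -> R) (x : R) :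
  measurable_fun setT X -> measurable [set w | x < X w].
Proof.
by move=> mX; rewrite -preimage_itvoy -[X in measurable X]setTI; exact: mX.
Qed.

(** On rectangles, the law of (X, Y) restricted to D agrees with P(D) times the product law, and
    rectangles determine it. Taking D to be the whole space gives the joint law of an independent
    pair; general D carries independence through the stick-breaking recursion. *)
Lemma joint_law_cond d (T : measurableType d) (P : probability T R)
    (X Y : {mfun T >-> R}) (D : set T) : measurable D ->
  (forall B C, measurable B -> measurable C ->
    P (X @^-1` B `&` Y @^-1` C `&` D) =
    (P (X @^-1` B) * P (Y @^-1` C) * P D)%E) ->
  forall A : set (R * R), measurable A ->
    P ([set w | A (X w, Y w)] `&` D) =
    (P D * (distribution P X \x distribution P Y) A)%E.
Proof.
move=> mD H A mA.
have mXY : measurable_fun setT (fun w => (X w, Y w)) by exact: measurable_fun_pair.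
pose m' := pushforward (mrestr P mD) (fun w => (X w, Y w)).
have pD0 : 0 <= pr P D by exact: pr_ge0.
(* The factor P(D) is absorbed into the first marginal, so that uniqueness of product measures
   applies. *)
pose m1 := mscale (NngNum pD0) (distribution P X).
have E B C : measurable B -> measurable C ->
    m' (B `*` C) = (m1 B * (distribution P Y) C)%E.
  move=> mB mC; rewrite /m' /m1 /pushforward/= /mrestr /mscale/= -prE//.
  rewrite /distribution/= /pushforward -muleA muleC -H//.
apply: (etrans (esym (@product_measure_unique _ _ _ _ _ m1 (distribution P Y) _ E A mA))) => //.
rewrite /product_measure1 ge0_integral_mscale//=; first by rewrite -prE.
exact: measurable_fun_xsection.
Qed.
End indep2_law.

Section independent_pairs.
Context (R : realType).

Lemma mfun_of_measurable d (T : measurableType d) (f : T -> R) : measurable_fun setT f ->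
  exists g : {mfun T >-> R}, g = f :> (T -> R).
Proof. by move=> mf; exists (mfun_Sub (mem_set mf)). Qed.

Section one_space.
Context d (T : measurableType d) (P : probability T R) (X Y : {mfun T >-> R}).
Hypothesis XY : indep2 P X Y.

Lemma joint_law (A : set (R * R)) : measurable A ->
  P [set w | A (X w, Y w)] = (distribution P X \x distribution P Y)%E A.
Proof.
move=> mA; rewrite -[LHS](congr1 P (setIT _)) (joint_law_cond measurableT)//.
  by rewrite probability_setT mul1e.
by move=> B C mB mC; rewrite setIT probability_setT mule1 XY.
Qed.

Lemma joint_law_indep (D : set T) : measurable D ->
  (forall B C, measurable B -> measurable C ->
    P (X @^-1` B `&` Y @^-1` C `&` D) =
    (P (X @^-1` B) * P (Y @^-1` C) * P D)%E) ->
  forall A : set (R * R), measurable A ->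
    P ([set w | A (X w, Y w)] `&` D) = (P [set w | A (X w, Y w)] * P D)%E.
Proof.
by move=> mD H A mA; rewrite (joint_law_cond mD H)// joint_law// muleC.
Qed.

(** Tonelli, read as conditioning on [X]; it serves to condition a weighted term on its weight. *)
Lemma joint_law_integral (A : set (R * R)) : measurable A ->
  P [set w | A (X w, Y w)] =
  (\int[P]_w P [set w' | A (X w, Y w')])%E.
Proof.
move=> mA; rewrite joint_law// /product_measure1 ge0_integral_distribution//.
  apply: eq_integral => w _ /=; rewrite /distribution /pushforward.
  by congr (P _); apply/seteqP; split => w' /=; rewrite /xsection/= inE.
exact: measurable_fun_xsection.
Qed.

Lemma indep2_expectation_mul (f g : R -> R) :
  measurable_fun setT f -> measurable_fun setT g ->
  (forall x, 0 <= f x) -> (forall x, 0 <= g x) ->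
  (\int[P]_w (f (X w) * g (Y w))%:E =
   \int[P]_w (f (X w))%:E * \int[P]_w (g (Y w))%:E)%E.
Proof.
move=> mf mg f0 g0.
pose h := fun p : R * R => (f p.1 * g p.2)%:E.
have mh : measurable_fun [set: R * R] h.
  by apply/measurable_EFinP; apply: measurable_funM; exact: measurableT_comp.
have h0 p : (0 <= h p)%E by rewrite lee_fin mulr_ge0.
have mXY : measurable_fun setT (fun w => (X w, Y w)) by exact: measurable_fun_pair.
transitivity (\int[pushforward P (fun w => (X w, Y w))]_p h p)%E.
  by rewrite ge0_integral_pushforward.
transitivity (\int[(distribution P X \x distribution P Y)%E]_p h p)%E.
  apply: eq_measure_integral => // A mA _.
  exact: joint_law.
rewrite fubini_tonelli1// /fubini_F.
under eq_integral => x _.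
  under eq_integral do rewrite /h/= EFinM.
  rewrite ge0_integralZl//; first over.
  - exact/measurable_EFinP.
  - by move=> y _; rewrite lee_fin.
  - by rewrite lee_fin.
have mf' : measurable_fun setT (EFin \o f) by exact/measurable_EFinP.
have mg' : measurable_fun setT (EFin \o g) by exact/measurable_EFinP.
have f0' y : (0 <= (EFin \o f) y)%E by rewrite lee_fin.
have g0' y : (0 <= (EFin \o g) y)%E by rewrite lee_fin.
rewrite ge0_integralZr//.
- by rewrite (ge0_integral_distribution X mf' f0') (ge0_integral_distribution Y mg' g0').
- by move=> x _; exact: f0'.
- by apply: integral_ge0 => x _; exact: g0'.
Qed.

End one_space.

Section two_spaces.
Context d (T : measurableType d) (P : probability T R) (X Y : {mfun T >-> R}).
Context d' (T' : measurableType d') (P' : probability T' R)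
  (X' Y' : {mfun T' >-> R}).
Hypotheses (XY : indep2 P X Y) (XY' : indep2 P' X' Y').
Hypotheses (XX' : same_law P X P' X') (YY' : same_law P Y P' Y').

Lemma same_law_pair (A : set (R * R)) : measurable A ->
  P [set w | A (X w, Y w)] = P' [set w | A (X' w, Y' w)].
Proof.
move=> mA; rewrite (joint_law XY)// (joint_law XY')//.
pose m' := (distribution P' X' \x distribution P' Y')%E.
have E B C : measurable B -> measurable C ->
    m' (B `*` C) = (distribution P X B * distribution P Y C)%E.
  move=> mB mC.
  have eB : distribution P X B = distribution P' X' B by exact: XX'.
  have eC : distribution P Y C = distribution P' Y' C by exact: YY'.
  by rewrite /m' product_measure1E// eB eC.
exact: (@product_measure_unique _ _ _ _ _ (distribution P X) (distribution P Y) _ E A mA).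
Qed.

Lemma same_law_comp (h : R * R -> R) : measurable_fun setT h ->
  same_law P (fun w => h (X w, Y w)) P' (fun w => h (X' w, Y' w)).
Proof.
move=> mh B mB; apply: (@same_law_pair (h @^-1` B)).
by rewrite -[X in measurable X]setTI; exact: mh.
Qed.

End two_spaces.

Section same_law_affine.
Context d (T : measurableType d) (P : probability T R) (X : T -> R).
Context d' (T' : measurableType d') (P' : probability T' R) (X' : T' -> R).

Lemma same_law_comp1 (h : R -> R) : measurable_fun setT h ->
  same_law P X P' X' -> same_law P (h \o X) P' (h \o X').
Proof.
move=> mh XX' B mB; apply: (XX' (h @^-1` B)).
by rewrite -[X in measurable X]setTI; exact: mh.
Qed.

Lemma same_law_sym : same_law P X P' X' -> same_law P' X' P X.
Proof. by move=> XX' B mB; rewrite XX'. Qed.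

Lemma same_law_trans d'' (T'' : measurableType d'') (P'' : probability T'' R)
    (X'' : T'' -> R) :
  same_law P X P' X' -> same_law P' X' P'' X'' -> same_law P X P'' X''.
Proof. by move=> h h' B mB; rewrite h// h'. Qed.

End same_law_affine.

Lemma indep2_comp d (T : measurableType d) (P : probability T R) (X Y : T -> R)
    (f g : R -> R) :
  measurable_fun setT f -> measurable_fun setT g ->
  indep2 P X Y -> indep2 P (f \o X) (g \o Y).
Proof.
move=> mf mg XY B C mB mC; apply: (XY (f @^-1` B) (g @^-1` C)).
  by rewrite -[X in measurable X]setTI; exact: mf.
by rewrite -[X in measurable X]setTI; exact: mg.
Qed.

Lemma mutually_independent2 d (T : measurableType d) (P : probability T R)
    (I : choiceType) (X : I -> T -> R) (i j : I) :
  mutually_independent P X -> i != j -> indep2 P (X i) (X j).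
Proof.
move=> indX ij B C mB mC.
have := indX [:: i; j] (fun k => if k == i then B else C).
rewrite /= !inE ij => /(_ isT)/=.
have mBC k : measurable (if k == i then B else C) by case: ifP.
move=> /(_ mBC).
rewrite !big_cons big_nil mule1 eqxx eq_sym (negbTE ij) => <-; congr (P _).
apply/seteqP; split => w /=.
  by move=> [Bw Cw] k /=; rewrite !inE => /orP[]/eqP->; rewrite ?eqxx// eq_sym (negbTE ij).
move=> H; split.
  by have /= := H i; rewrite !inE eqxx; exact.
by have /= := H j; rewrite !inE eqxx orbT [j == i]eq_sym (negbTE ij); exact.
Qed.

Lemma mutually_independent3 d (T : measurableType d) (P : probability T R)
    (I : choiceType) (X : I -> T -> R) (i j k : I) (A B C : set R) :
  mutually_independent P X -> uniq [:: i; j; k] ->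
  measurable A -> measurable B -> measurable C ->
  P (X i @^-1` A `&` X j @^-1` B `&` X k @^-1` C) =
  (P (X i @^-1` A) * P (X j @^-1` B) * P (X k @^-1` C))%E.
Proof.
move=> indX uijk mA mB mC.
have := indX [:: i; j; k] (fun l => if l == i then A else if l == j then B else C) uijk.
move: uijk; rewrite /= !inE negb_or andbT => /andP[/andP[ij ik] jk].
have mABC l : measurable (if l == i then A else if l == j then B else C).
  by case: ifP => // _; case: ifP.
have ji : (j == i) = false by rewrite eq_sym (negbTE ij).
have ki : (k == i) = false by rewrite eq_sym (negbTE ik).
have kj : (k == j) = false by rewrite eq_sym (negbTE jk).
move=> /(_ mABC).
rewrite !big_cons big_nil mule1 !eqxx ji ki kj muleA => <-; congr (P _).
apply/seteqP; split => w /=.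
  by move=> [[Aw Bw] Cw] l /=; rewrite !inE => /or3P[]/eqP->; rewrite ?eqxx ?ji ?ki ?kj.
move=> H; split; first split.
- by have /= := H i; rewrite !inE eqxx; exact.
- by have /= := H j; rewrite !inE eqxx orbT ji; exact.
- by have /= := H k; rewrite !inE eqxx !orbT ki kj; exact.
Qed.

End independent_pairs.

(** * Tails of strictly stable walks *)

Section walk.
Context (R : realType) (alpha : R).

(** The scaling clause is strict stability: it has no centering term. The times [t i] may repeat, so
    a finite partition is encoded as a sequence that becomes constant. *)
Definition stable_walk d (T : measurableType d) (P : probability T R)
    (W : nat -> {mfun T >-> R}) : Prop :=
  [/\ (forall w, W 0%N w = 0),
      (forall t : nat -> nat, (forall i, (t i <= t i.+1)%N) ->
         mutually_independent P (fun i w => W (t i.+1) w - W (t i) w)) &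
      (forall s t, (s < t)%N -> same_law P (fun w => W t w - W s w)
         P (fun w => (t - s)%:R `^ alpha^-1 * W 1%N w))].

Context (halpha : 0 < alpha).
Context d (T : measurableType d) (P : probability T R) (W : nat -> {mfun T >-> R}).
Hypothesis hW : stable_walk P W.

Definition tailp (x : R) : R := pr P [set w | x < W 1%N w].
Local Notation F := tailp.
Local Notation rt n := (n%:R `^ alpha^-1).

Lemma rt_gt0 (n : nat) : (0 < n)%N -> 0 < rt n :> R.
Proof. by move=> n0; rewrite powR_gt0// ltr0n. Qed.

Lemma le_rt (m n : nat) : (m <= n)%N -> rt m <= rt n :> R.
Proof.
by move=> mn; rewrite ge0_ler_powR ?invr_ge0 ?(ltW halpha)// ?nnegrE// ler_nat.
Qed.

Lemma rtK (n : nat) : rt n `^ alpha = n%:R :> R.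
Proof. by rewrite -powRrM mulVf ?gt_eqF// powRr1. Qed.

Lemma tailp_ge0 x : 0 <= F x. Proof. exact: pr_ge0. Qed.

Lemma tailp_le1 x : F x <= 1. Proof. by apply: pr_le1; exact: measurable_gt_set. Qed.

Lemma tailp_mono x y : x <= y -> F y <= F x.
Proof.
by move=> xy; apply: pr_mono; [exact: measurable_gt_set|exact: measurable_gt_set|move=> w /=; exact: le_lt_trans].
Qed.

Lemma tailp_cvg0 (e : R) : 0 < e -> exists2 A, 0 < A & forall x, A <= x -> F x <= e.
Proof.
move=> e0.
have := @cvg_ccdfy0 _ _ _ P (W 1%N) => /fine_cvg /cvgrPdist_le /(_ e e0)[A [_ HA]].
exists (`|A| + 1) => [|x Ax]; first by rewrite ltr_wpDl.
have /HA : A < x by apply: lt_le_trans Ax; rewrite (le_lt_trans (ler_norm A))// ltrDl.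
rewrite /= sub0r normrN => /(le_trans (ler_norm _)); congr (_ <= _).
rewrite /F /pr /ccdf /distribution /pushforward; congr (fine (P _)).
by apply/seteqP; split => w /=; rewrite in_itv/= andbT.
Qed.

Lemma lower_cvg1 (e : R) : 0 < e ->
  exists2 A, 0 < A & forall x, A <= x -> 1 - e <= pr P [set w | - x < W 1%N w].
Proof.
move=> e0.
have := @cvg_ccdfNy1 _ _ _ P (W 1%N) => /fine_cvg /cvgrPdist_le /(_ e e0)[A [_ HA]].
exists (`|A| + 1) => [|x Ax]; first by rewrite ltr_wpDl.
have /HA : - x < A.
  rewrite ltrNl (lt_le_trans _ Ax)// (le_lt_trans (ler_norm (- A)))// normrN.
  by rewrite ltrDl.
rewrite /= => /(le_trans (ler_norm _)); rewrite lerBlDr addrC -lerBlDr.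
congr (_ <= _).
rewrite /pr /ccdf /distribution /pushforward; congr (fine (P _)).
by apply/seteqP; split => w /=; rewrite in_itv/= andbT.
Qed.

Lemma measurable_increment (s t : nat) : measurable_fun setT (fun w => W t w - W s w).
Proof. exact: measurable_funB. Qed.

Lemma pr_increment (s t : nat) (x : R) : (s < t)%N ->
  pr P [set w | x < W t w - W s w] = F (x / rt (t - s)).
Proof.
move=> st; have [_ _ /(_ _ _ st) law] := hW.
have r0 : 0 < rt (t - s) :> R by rewrite rt_gt0// subn_gt0.
rewrite -(preimage_itvoy (fun w => W t w - W s w)) /pr law// /F /pr; congr (fine (P _)).
by apply/seteqP; split => w /=; rewrite in_itv/= andbT ltr_pdivrMr// mulrC.
Qed.

(** A block of at most n steps fluctuates on a scale of at most n^(1/alpha). The case s = t is the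
    empty block before the first or after the last step. *)
Lemma increment_lower (s t n : nat) (K : R) : 0 < K -> (s <= t)%N -> (t - s <= n)%N ->
  (0 < n)%N ->
  pr P [set w | - K < W 1%N w] <= pr P [set w | - (K * rt n) < W t w - W s w].
Proof.
move=> K0; rewrite leq_eqVlt => /predU1P[<-|st] tsn n0.
  have -> : [set w | - (K * rt n) < W s w - W s w] = setT.
    apply/seteqP; split => w //= _.
    by rewrite subrr oppr_lt0 mulr_gt0// rt_gt0.
  by rewrite prT pr_le1//; exact: measurable_gt_set.
rewrite pr_increment//; apply: tailp_mono.
have r0 : 0 < rt (t - s) :> R by rewrite rt_gt0// subn_gt0.
rewrite ler_pdivrMr// mulNr lerN2 ler_pM2l//; exact: le_rt.
Qed.

(* One big jump: the walk exceeds y - 2 K n^(1/alpha) as soon as one of its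
   first n steps exceeds y while the walk before and after that step stays
   above - K n^(1/alpha). *)
Lemma one_big_jump (n : nat) (y K : R) : (0 < n)%N -> 0 < K ->
  n%:R * (F y * pr P [set w | - K < W 1%N w] ^+ 2) <=
  F (y / rt n - 2 * K) + (n%:R * F y) ^+ 2.
Proof.
move=> n0 K0; have [W0 indW law] := hW.
set q := pr P _.
have r0 : 0 < rt n :> R by rewrite rt_gt0.
pose A i := [set w | - (K * rt n) < W i w - W 0%N w].
pose J i := [set w | y < W i.+1 w - W i w].
pose B i := [set w | - (K * rt n) < W n w - W i.+1 w].
have mA i : measurable (A i) by apply: measurable_gt_set; exact: measurable_increment.
have mJ i : measurable (J i) by apply: measurable_gt_set; exact: measurable_increment.
have mB i : measurable (B i) by apply: measurable_gt_set; exact: measurable_increment.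
pose E i := A i `&` J i `&` B i.
have mE i : measurable (E i) by apply: measurableI => //; exact: measurableI.
have prJ i : pr P (J i) = F y.
  by rewrite pr_increment// subSnn powR1 divr1.
have leE i : (i < n)%N -> F y * q ^+ 2 <= pr P (E i).
  move=> ni.
  (* The default value [n] of [nth] completes the times to 0, i, i + 1, n, n, ..., so that the
     increments 0, 1, 2 are the walk before step i, step i itself, and the walk after it. *)
  have tm k : (nth n [:: 0; i; i.+1]%N k <= nth n [:: 0; i; i.+1]%N k.+1)%N.
    by case: k => [|[|[|k]]] //=; rewrite nth_nil.
  have := @mutually_independent3 R _ T P _ _ 0%N 1%N 2%N
    `]- (K * rt n), +oo[ `]y, +oo[ `]- (K * rt n), +oo[ (indW _ tm).
  rewrite /=; move=> /(_ isT (measurable_itv _) (measurable_itv _) (measurable_itv _)).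
  rewrite !preimage_itvoy -/(A i) -/(J i) -/(B i) -/(E i) (prE P (mA i)) (prE P (mJ i)).
  rewrite (prE P (mB i)) (prE P (mE i)) -!EFinM. move=> -[->].
  rewrite prJ (_ : pr P (A i) * F y * pr P (B i) = F y * (pr P (A i) * pr P (B i))); last by ring.
  rewrite expr2; apply: ler_wpM2l; first exact: tailp_ge0.
  apply: ler_pM; rewrite ?pr_ge0//.
    by apply: increment_lower; rewrite ?subn0 ?(ltnW ni).
  by apply: increment_lower => //; rewrite leq_subr.
have prEE i j : (i < j < n)%N -> pr P (E i `&` E j) <= F y ^+ 2.
  move=> /andP[ij jn].
  have mJJ : measurable (J i `&` J j) by exact: measurableI.
  have -> : F y ^+ 2 = pr P (J i `&` J j).
    have := mutually_independent2 (indW id (fun k => leqnSn k)) (_ : i != j).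
    rewrite neq_ltn ij => /(_ isT) /(_ `]y, +oo[%classic `]y, +oo[%classic (measurable_itv _) (measurable_itv _)).
    rewrite !preimage_itvoy -/(J i) -/(J j) (prE P (mJ i)) (prE P (mJ j)) (prE P mJJ) -EFinM.
    by move=> -[->]; rewrite !prJ.
  apply: pr_mono => //; first exact: measurableI.
  by move=> w [[[_ ?] _] [[_ ?] _]].
have := bonferroni (sqr_ge0 (F y)) mE prEE.
have -> : n%:R ^+ 2 * F y ^+ 2 = (n%:R * F y) ^+ 2 by rewrite exprMn.
move=> H; apply: le_trans (le_trans H _).
  rewrite mulr_natl -[n in _ *+ n]card_ord -sumr_const; apply: ler_sum => i _.
  exact: leE.
rewrite lerD2r.
have -> : F (y / rt n - 2 * K) = pr P [set w | y - 2 * (K * rt n) < W n w - W 0%N w].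
  rewrite pr_increment// subn0; congr F; rewrite mulrBl; congr (_ - _).
  by rewrite -mulrA mulfK// gt_eqF.
apply: pr_mono.
- by apply: bigsetU_measurable.
- by apply: measurable_gt_set; exact: measurable_increment.
- rewrite -bigcup_mkord => w [i _] /= [[]]; rewrite /A /J /B /=.
  lra.
Qed.

End walk.

Lemma one_powR (R : realType) (a : R) : 1 `^ a = 1 :> R.
Proof. by rewrite powR1. Qed.

(** * Upper bound of order x^(-alpha) for the tail of a strictly stable walk *)

Section walk_tail.
Context (R : realType) (alpha : R).
Context (halpha : 0 < alpha).
Context d (T : measurableType d) (P : probability T R) (W : nat -> {mfun T >-> R}).
Hypothesis hW : stable_walk alpha P W.

Local Notation F := (tailp P W).
Local Notation rt n := (n%:R `^ alpha^-1).

Lemma powRVK (x : R) : 0 <= x -> (x `^ alpha) `^ alpha^-1 = x.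
Proof. by move=> x0; rewrite -powRrM mulfV ?gt_eqF// powRr1. Qed.

(** Here n is the integer part of (x / x0)^alpha. Estimates along the points x0 n^(1/alpha) thereby
    extend to all x >= x0. *)
Lemma rt_bracket (x0 x : R) : 0 < x0 -> x0 <= x ->
  exists n, [/\ (0 < n)%N, x0 * rt n <= x, x < x0 * rt n.+1 &
                n%:R <= (x / x0) `^ alpha < n.+1%:R].
Proof.
move=> x00 x0x.
have xx0 : 1 <= x / x0 by rewrite ler_pdivlMr// mul1r.
pose z := (x / x0) `^ alpha.
have z1 : 1 <= z by rewrite -(one_powR alpha) ge0_ler_powR ?nnegrE ?(ltW halpha)// (le_trans ler01).
have /truncn_itv /andP[nz zn] : 0 <= z by rewrite (le_trans ler01).
have xE : x = x0 * z `^ alpha^-1.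
  by rewrite powRVK ?(le_trans ler01)// mulrCA mulfV ?mulr1// gt_eqF.
exists (Num.truncn z); split.
- by rewrite truncn_gt0.
- rewrite [leRHS]xE ler_pM2l// ge0_ler_powR ?nnegrE ?invr_ge0 ?(ltW halpha)//.
  exact: powR_ge0.
- rewrite [ltLHS]xE ltr_pM2l// gt0_ltr_powR ?nnegrE ?invr_gt0//.
  exact: powR_ge0.
- by rewrite nz zn.
Qed.

(** Fix the threshold y = x0 n^(1/alpha) and let u = m F(y) for m <= n. The one-big-jump bound for m
    steps reads 3 u / 4 <= 1 / 16 + u^2, which no u in the interval ]1/4, 5/16] satisfies. As m
    grows from 0 to n, u moves by at most 1/16 at a time and cannot cross this gap, so n F(y) <=
    1/4. *)
Lemma tailp_bound : exists2 C, 0 < C & forall x, 0 < x -> F x <= C * x `^ (- alpha).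
Proof.
have e8 : 0 < (1 / 8 : R) by lra.
have e16 : 0 < (1 / 16 : R) by lra.
have [K K0 /(_ K (lexx _)) HK] := lower_cvg1 P W e8.
have [A A0 HA] := tailp_cvg0 P W e16.
(* The summand 2 K makes up for the 2 K lost in [one_big_jump]. *)
pose x0 := A + 2 * K.
have x00 : 0 < x0 by rewrite addr_gt0// mulr_gt0.
have q34 : 3 / 4 <= pr P [set w | - K < W 1%N w] ^+ 2.
  have : (1 - 1 / 8) ^+ 2 <= pr P [set w | - K < W 1%N w] ^+ 2.
    by rewrite ler_pXn2r ?nnegrE ?pr_ge0//; lra.
  by lra.
have main n : (0 < n)%N -> n%:R * F (x0 * rt n) <= 1 / 4.
  move=> n0; set p := F _.
  have r1 : 1 <= rt n :> R by rewrite -[leLHS](one_powR alpha^-1); exact: (@le_rt _ _ halpha 1%N).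
  have p16 : p <= 1 / 16.
    apply: HA; rewrite (le_trans (_ : A <= x0))//; first by rewrite lerDl mulr_ge0// ltW.
    by rewrite ler_peMr// ltW.
  have p0 : 0 <= p by exact: tailp_ge0.
  suff H m : (m <= n)%N -> m%:R * p <= 1 / 4 by exact: H.
  elim: m => [|m IH] mn; first by rewrite mul0r; lra.
  have mp := IH (ltnW mn).
  have := @one_big_jump _ _ halpha _ _ P W hW m.+1 (x0 * rt n) K isT K0.
  rewrite -/p.
  have : F (x0 * rt n / rt m.+1 - 2 * K) <= 1 / 16.
    apply: HA; rewrite lerBrDr -/x0 -mulrA ler_peMr ?(ltW x00)//.
    by rewrite ler_pdivlMr ?rt_gt0// mul1r le_rt.
  have u0 : 0 <= m.+1%:R * p by rewrite mulr_ge0.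
  rewrite mulrA.
  have : m.+1%:R * p * (3 / 4) <= m.+1%:R * p * pr P [set w | - K < W 1%N w] ^+ 2.
    exact: ler_wpM2l.
  have : m.+1%:R * p <= 5 / 16 by rewrite -natr1 mulrDl mul1r; lra.
  move: (m.+1%:R * p) u0 => u u0 u1 Hu H1 H2.
  rewrite leNgt; apply/negP => u2.
  have : u * (3 / 4) <= 1 / 16 + u ^+ 2 by lra.
  nra.
exists (x0 `^ alpha); first by rewrite powR_gt0.
move=> x x_gt0; rewrite powRN -ler_pdivrMr ?invr_gt0 ?powR_gt0// invrK.
have [xx0|x0x] := ltP x x0.
  apply: (@le_trans _ _ (1 * x `^ alpha)).
    by rewrite ler_wpM2r ?powR_ge0// tailp_le1.
  by rewrite mul1r ge0_ler_powR ?nnegrE ?(ltW halpha)// ltW.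
have [n [n0 nx xn /andP[_ zn]]] := rt_bracket x00 x0x.
have xE : x `^ alpha = x0 `^ alpha * (x / x0) `^ alpha.
  rewrite -powRM ?(ltW x00)//; last by rewrite divr_ge0 ?(ltW x_gt0)// ltW.
  by rewrite mulrCA mulfV ?mulr1// gt_eqF.
rewrite xE mulrCA -[leRHS]mulr1 ler_pM2l ?powR_gt0//.
apply: (@le_trans _ _ (F (x0 * rt n) * n.+1%:R)).
  by apply: ler_pM; rewrite ?tailp_ge0 ?powR_ge0 ?(ltW zn)// tailp_mono.
have := main _ n0; rewrite -[n.+1%:R]natr1 mulrDr mulr1 mulrC => Hn.
have : F (x0 * rt n) <= n%:R * F (x0 * rt n).
  by rewrite ler_peMl ?tailp_ge0// ler1n.
lra.
Qed.

End walk_tail.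

(** * Existence of the tail constant *)

Section asymptotic_limit.
Context (R : realType).

(* The limit is the infimum of the eventual upper bounds of f. *)
Lemma cvg_of_eventual_bound (f : R -> R) :
  (forall x, 0 < x -> 0 <= f x) ->
  (forall eta, 0 < eta -> exists2 A, 0 < A & forall x, A <= x ->
     exists B, forall y, B <= y -> f y <= f x + eta) ->
  exists2 c : R, 0 <= c & f x @[x --> +oo] --> c.
Proof.
move=> f0 H.
pose U := [set u | exists B, forall y, B <= y -> f y <= u].
have U0 u : U u -> 0 <= u.
  move=> [B HB]; have := HB (`|B| + 1); rewrite (le_trans (ler_norm B)) ?lerDl//.
  by move=> /(_ isT); apply: le_trans; apply: f0; rewrite ltr_wpDl.
have Une : U !=set0.
  have [A _ /(_ A (lexx _)) [B HB]] := H 1 ltr01.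
  by exists (f A + 1); exists B.
have Ulb : has_lbound U by exists 0 => u; exact: U0.
exists (inf U); first by apply: lb_le_inf.
apply/cvgrPdist_le => e e0.
have [A _ HA] := H e e0.
have [u [B HB] uc] := inf_adherent e0 (conj Une Ulb).
exists (`|A| + `|B|); split; first exact: num_real.
move=> x ABx; rewrite ler_distlC; apply/andP; split.
- rewrite lerBlDr; apply: ge_inf => //; apply: HA.
  by rewrite (le_trans (ler_norm A))// (le_trans _ (ltW ABx))// lerDl.
- apply: le_trans (ltW uc); apply: HB.
  by rewrite (le_trans (ler_norm B))// (le_trans _ (ltW ABx))// lerDr.
Qed.

End asymptotic_limit.

Section walk_limit.
Context (R : realType) (alpha : R).
Context (halpha : 0 < alpha).
Context d (T : measurableType d) (P : probability T R) (W : nat -> {mfun T >-> R}).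
Hypothesis hW : stable_walk alpha P W.

Local Notation F := (tailp P W).
Local Notation rt n := (n%:R `^ alpha^-1).

(** Put f(x) = x^alpha F(x). With y = lam x n^(1/alpha) and 2 K = (lam - 1) x, the one-big-jump
    bound compares n F(y) with F(x): f(y) is at most f(x) up to errors of order k C, where lam^alpha
    = 1 + k. Hence every f(x) with x large bounds f from some point on, up to eta. *)
Lemma tailp_cvg : exists2 c : R, 0 <= c & x `^ alpha * F x @[x --> +oo] --> c.
Proof.
apply: cvg_of_eventual_bound => [x x0|eta eta0].
  by rewrite mulr_ge0 ?powR_ge0// tailp_ge0.
have [C C0 HC] := tailp_bound halpha hW.
have fC x : 0 < x -> x `^ alpha * F x <= C.
  by move=> x0; rewrite mulrC -ler_pdivlMr ?powR_gt0// -powRN HC.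
(* The errors amount to 3 k C at the points lam x n^(1/alpha) and k C between two consecutive ones,
   which stays below 5 k C = eta. *)
pose k := eta / (5 * C).
have k0 : 0 < k by rewrite divr_gt0// mulr_gt0.
pose lam := (1 + k) `^ alpha^-1.
have lamE : lam `^ alpha = 1 + k.
  by rewrite -powRrM mulVf ?gt_eqF// powRr1// addr_ge0// ltW.
have lam1 : 1 < lam.
  rewrite -[ltLHS](one_powR alpha^-1) gt0_ltr_powR ?invr_gt0 ?nnegrE//.
    by rewrite addr_ge0// ltW.
  by rewrite ltrDl.
have lam0 : 0 < lam by rewrite (lt_trans ltr01).
have k20 : 0 < k / 2 by rewrite divr_gt0.
have [A1 A10 HA1] := lower_cvg1 P W k20.
(* From [A2] on, C x^(-alpha) <= k; this makes the quadratic term (n F(y))^2 at most k n F(y). *)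
pose A2 := (C / k) `^ alpha^-1.
have A20 : 0 < A2 by rewrite powR_gt0// divr_gt0.
have A2E : A2 `^ alpha = C / k.
  by rewrite -powRrM mulVf ?gt_eqF// powRr1// divr_ge0 ?(ltW C0)// ltW.
exists (2 * A1 / (lam - 1) + A2).
  by rewrite addr_gt0// divr_gt0 ?mulr_gt0// subr_gt0.
move=> x xA.
have l10 : 0 < lam - 1 by rewrite subr_gt0.
have xA1 : 2 * A1 / (lam - 1) <= x by rewrite (le_trans _ xA)// lerDl ltW.
have xA2 : A2 <= x.
  by rewrite (le_trans _ xA)// lerDr divr_ge0 ?mulr_ge0// ltW.
have x0 : 0 < x by exact: lt_le_trans xA2.
pose K := (lam - 1) * x / 2.
have KA1 : A1 <= K.
  by rewrite /K ler_pdivlMr// mulrC [leRHS]mulrC -ler_pdivrMr.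
have K0 : 0 < K by exact: lt_le_trans KA1.
set q := pr P [set w | - K < W 1%N w].
have q1 : 1 - k / 2 <= q by exact: HA1.
have q1' : q <= 1 by apply: pr_le1; exact: measurable_gt_set.
have q0 : 0 <= q by exact: pr_ge0.
pose x' := lam * x.
have x'0 : 0 < x' by rewrite mulr_gt0.
have xx' : x <= x' by rewrite ler_peMl ?(ltW x0)// ltW.
pose f y := y `^ alpha * F y.
have step n : (0 < n)%N -> f (x' * rt n) <= f x + 3 * (k * C).
  move=> n0.
  have r0 : 0 < rt n :> R by exact: rt_gt0.
  have := one_big_jump halpha hW (x' * rt n) n0 K0; rewrite -/q.
  have -> : x' * rt n / rt n - 2 * K = x.
    by rewrite mulfK ?gt_eqF// /x' /K; field.
  set p := F (x' * rt n) => Hp.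
  have fE : f (x' * rt n) = x' `^ alpha * (n%:R * p).
    by rewrite /f powRM ?(ltW x'0) ?(ltW r0)// rtK// mulrA.
  have fnC : f (x' * rt n) <= C by apply: fC; rewrite mulr_gt0.
  have xa0 : 0 < x' `^ alpha by rewrite powR_gt0.
  have fn0 : 0 <= f (x' * rt n) by rewrite mulr_ge0 ?powR_ge0 ?tailp_ge0.
  have fx0 : 0 <= f x by rewrite mulr_ge0 ?powR_ge0 ?tailp_ge0.
  have fxC : f x <= C by exact: fC.
  have h1 : f (x' * rt n) * q ^+ 2 <= (1 + k) * f x + f (x' * rt n) * (n%:R * p).
    have -> : (1 + k) * f x = x' `^ alpha * F x.
      by rewrite /f -lamE mulrA -powRM// ltW.
    rewrite fE (_ : _ * _ * q ^+ 2 = x' `^ alpha * (n%:R * (p * q ^+ 2))); last by ring.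
    rewrite (_ : _ + _ = x' `^ alpha * (F x + (n%:R * p) ^+ 2)); last by ring.
    by rewrite ler_pM2l.
  have h2 : n%:R * p <= k.
    have : x' `^ alpha * (n%:R * p) <= C by rewrite -fE.
    rewrite mulrC -ler_pdivlMr// => /le_trans; apply.
    rewrite ler_pdivrMr// mulrC -ler_pdivrMr// -A2E.
    by apply: ge0_ler_powR; rewrite ?nnegrE ?(ltW halpha) ?(ltW A20) ?(ltW x'0)// (le_trans xA2).
  have h3 : 1 - k <= q ^+ 2.
    by have := sqr_ge0 (q - 1); rewrite sqrrB1; move: q1; clear; lra.
  have : f (x' * rt n) * (n%:R * p) <= C * k.
    by apply: ler_pM => //; rewrite mulr_ge0 ?tailp_ge0.
  have : f (x' * rt n) * (1 - k) <= f (x' * rt n) * q ^+ 2 by exact: ler_wpM2l.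
  have : f (x' * rt n) * k <= C * k by rewrite ler_wpM2r// ltW.
  have : k * f x <= k * C by rewrite ler_wpM2l// ltW.
  move: h1; rewrite mulrBr mulr1 mulrDl mul1r [C * k]mulrC.
  move: (f (x' * rt n) * (n%:R * p)) (f (x' * rt n) * q ^+ 2) (f (x' * rt n) * k) (k * f x) (k * C).
  by clear; move=> u1 u2 u3 u4 u5; lra.
(* Beyond this point the bracketing integer n is at least 1 / k, so passing from n to n + 1 costs a
   factor of at most 1 + k. *)
exists (x' * (k^-1 + 1) `^ alpha^-1) => y yB.
have k1 : 1 <= k^-1 + 1 by rewrite lerDr invr_ge0 ltW.
have x'y : x' <= y.
  rewrite (le_trans _ yB)// ler_peMr ?(ltW x'0)// -[leLHS](one_powR alpha^-1).
  by rewrite ge0_ler_powR ?nnegrE ?invr_ge0 ?(ltW halpha)// (le_trans ler01).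
have [n [n0 ny yn /andP[_ zn]]] := rt_bracket halpha x'0 x'y.
have y0 : 0 < y by exact: lt_le_trans x'y.
have kn : k^-1 <= n%:R.
  have : k^-1 + 1 < n.+1%:R.
    apply: le_lt_trans zn.
    have yx : (k^-1 + 1) `^ alpha^-1 <= y / x' by rewrite ler_pdivlMr// mulrC.
    have -> : k^-1 + 1 = ((k^-1 + 1) `^ alpha^-1) `^ alpha.
      by rewrite -powRrM mulVf ?gt_eqF// powRr1// (le_trans ler01).
    apply: ge0_ler_powR; rewrite ?nnegrE ?powR_ge0 ?(ltW halpha)//.
    by rewrite divr_ge0 // ltW.
  by rewrite -natr1 ltrD2r => /ltW.
have n0' : 0 < n%:R :> R by rewrite ltr0n.
have : f y <= n.+1%:R / n%:R * f (x' * rt n).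
  rewrite /f powRM ?(ltW x'0) ?powR_ge0// rtK//.
  rewrite (_ : _ / _ * _ = (x' `^ alpha * n.+1%:R) * F (x' * rt n)); last first.
    by field; rewrite gt_eqF.
  apply: ler_pM; rewrite ?powR_ge0 ?tailp_ge0//; last exact: tailp_mono.
  apply: (@le_trans _ _ ((x' * rt n.+1) `^ alpha)).
    rewrite ge0_ler_powR ?nnegrE ?(ltW halpha) ?(ltW y0) ?(ltW yn)//.
    by rewrite mulr_ge0 ?powR_ge0// ltW.
  by rewrite powRM ?(ltW x'0) ?powR_ge0// rtK.
rewrite -natr1 mulrDl divff ?gt_eqF// mulrDl [1 * f _]mul1r => H1.
have fnC : f (x' * rt n) <= C by apply: fC; rewrite mulr_gt0// rt_gt0.
have fn0 : 0 <= f (x' * rt n) by rewrite mulr_ge0 ?powR_ge0 ?tailp_ge0.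
have H2 : 1 / n%:R * f (x' * rt n) <= k * C.
  apply: ler_pM => //.
  by rewrite mul1r invf_ple ?posrE.
have H3 := step _ n0.
have H4 : 5 * (k * C) = eta.
  by rewrite /k; field; rewrite gt_eqF.
rewrite -/(f x) -/(f y).
have H5 : 0 <= k * C by rewrite mulr_ge0// ltW.
move: H1 H2 H3 H4 H5.
move: (f y) (f x) (1 / n%:R * f (x' * rt n)) (k * C) (f (x' * rt n)); clear.
by move=> u1 u2 u3 u4 u5; lra.
Qed.

End walk_limit.

Lemma powR_exprn (R : realType) (y a : R) k : 0 <= y -> (y ^+ k) `^ a = (y `^ a) ^+ k.
Proof.
move=> y0; elim: k => [|k IH]; first by rewrite !expr0 one_powR.
by rewrite !exprS powRM ?exprn_ge0// IH.
Qed.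

(** * Improvement of the tail exponent when the tail constant vanishes *)

Section walk_split.
Context (R : realType) (alpha : R).
Context (halpha : 0 < alpha).
Context d (T : measurableType d) (P : probability T R) (W : nat -> {mfun T >-> R}).
Hypothesis hW : stable_walk alpha P W.

Local Notation F := (tailp P W).
Local Notation rt n := (n%:R `^ alpha^-1).

Lemma walk_indep2 : indep2 P (fun w => W 1%N w - W 0%N w) (fun w => W 2%N w - W 1%N w).
Proof. by have [_ ind _] := hW; exact: (mutually_independent2 (ind id (fun k => leqnSn k)) (_ : 0%N != 1%N)). Qed.

(** If neither of two steps exceeds s, a sum above s + t forces both of them to exceed t. *)
Lemma tailp_split (s t : R) : F ((s + t) / rt 2) <= 2 * F s + F t ^+ 2.
Proof.
pose J i (x : R) := [set w | x < W i.+1 w - W i w].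
have mJ i x : measurable (J i x) by apply: measurable_gt_set; exact: measurable_increment.
have prJ i x : pr P (J i x) = F x.
  by rewrite (pr_increment hW)// subSnn one_powR divr1.
have mJJ : measurable (J 0%N t `&` J 1%N t) by exact: measurableI.
have prJJ : pr P (J 0%N t `&` J 1%N t) = F t ^+ 2.
  have := walk_indep2 (measurable_itv `]t, +oo[) (measurable_itv `]t, +oo[).
  rewrite !preimage_itvoy -/(J 0%N t) -/(J 1%N t) (prE P (mJ _ _)) (prE P (mJ 1%N t)) (prE P mJJ) -EFinM.
  by move=> -[->]; rewrite !prJ expr2.
have mU : measurable (J 0%N s `|` J 1%N s) by exact: measurableU.
have -> : F ((s + t) / rt 2) = pr P [set w | s + t < W 2%N w - W 0%N w].
  by rewrite (pr_increment hW).
apply: (@le_trans _ _ (pr P (J 0%N s `|` J 1%N s `|` (J 0%N t `&` J 1%N t)))).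
  apply: pr_mono.
  - by apply: measurable_gt_set; exact: measurable_increment.
  - exact: measurableU.
  - move=> w /= H; rewrite /J/=.
    have [|h0] := ltP s (W 1%N w - W 0%N w); first by left; left.
    have [|h1] := ltP s (W 2%N w - W 1%N w); first by left; right.
    by right; split; lra.
apply: (le_trans (prU_le _ mU mJJ)).
rewrite prJJ lerD2r (le_trans (prU_le _ (mJ _ _) (mJ _ _)))// !prJ; lra.
Qed.

End walk_split.

Section tail_iteration.
Context (R : realType) (alpha C : R) (F : R -> R).
Hypothesis halpha : 0 < alpha.
Hypothesis F0 : forall x, 0 <= F x.
Hypothesis F_mono : forall x y, x <= y -> F y <= F x.
Hypothesis FC : forall x, 0 < x -> F x <= C * x `^ (- alpha).
Hypothesis F_split : forall s t,
  F ((s + t) / 2%:R `^ alpha^-1) <= 2 * F s + F t ^+ 2.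
Hypothesis F_lim : x `^ alpha * F x @[x --> +oo] --> (0 : R).

(* Iterating [F_split] along s = a_(k+1) x 2^((k+1)/alpha) with a_k = (1 + r^k)/2,
   where r is so close to 1 that the squared error terms are summable. *)
Lemma tail_improvement : exists D, forall x, 0 < x -> F x <= D * x `^ (- (2 * alpha)).
Proof.
pose lam : R := 2%:R `^ alpha^-1.
have lam0 : 0 < lam by rewrite powR_gt0.
have lamE : lam `^ alpha = 2 by rewrite -powRrM mulVf ?gt_eqF// powRr1.
(* This choice gives r^(-2 alpha) = 3/2: the k-th error term then carries 2^k (3/2)^k 4^(-k) =
   (3/4)^k, and these factors sum to at most 4. *)
pose r : R := (2 / 3) `^ (2 * alpha)^-1.
have r0 : 0 < r by rewrite powR_gt0//; lra.
have a20 : 0 < 2 * alpha by rewrite mulr_gt0.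
have r1 : r < 1.
  by rewrite -(one_powR (2 * alpha)^-1) gt0_ltr_powR ?invr_gt0 ?nnegrE//; lra.
have rE : (r `^ (- alpha)) ^+ 2 = 3 / 2.
  rewrite -powR_mulrn ?powR_ge0// -powRrM mulNr [alpha * _]mulrC powRN -powRrM.
  by rewrite mulVf ?gt_eqF// powRr1; [field|lra].
pose a k := (1 + r ^+ k) / 2.
pose D0 := C ^+ 2 * (((1 - r) / 2) `^ (- alpha)) ^+ 2 / 4.
have D00 : 0 <= D0 by rewrite divr_ge0// mulr_ge0// sqr_ge0.
exists (4 * D0) => x x0.
have xE : x `^ (- (2 * alpha)) = (x `^ (- alpha)) ^+ 2.
  by rewrite -powR_mulrn ?powR_ge0// -powRrM mulNr mulrC.
rewrite xE.
set X := (x `^ (- alpha)) ^+ 2.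
have X0 : 0 <= X by exact: sqr_ge0.
have iter k : F x <= 2 ^+ k * F (a k * x * lam ^+ k) +
    D0 * X * \sum_(j < k) (3 / 4) ^+ j.
  elim: k => [|k IH].
    rewrite big_ord0 mulr0 addr0 expr0 mul1r mulr1 /a expr0.
    by rewrite (_ : (1 + 1) / 2 = 1) ?mul1r//; field.
  apply: (le_trans IH); rewrite big_ord_recr/= mulrDr addrA [leRHS]addrAC lerD2r.
  pose s := a k.+1 * x * lam ^+ k.+1.
  (* The coefficient r^k (1 - r) / 2 is a_k - a_(k+1), so that (s + t) / lam is the argument reached
     at stage k. *)
  pose t := r ^+ k * ((1 - r) / 2) * x * lam ^+ k.+1.
  have r20 : 0 < (1 - r) / 2 by rewrite divr_gt0// subr_gt0.
  have t0 : 0 < t 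
    by apply: mulr_gt0; [apply: mulr_gt0 => //; apply: mulr_gt0 => //|]; exact: exprn_gt0.
  have := F_split s t; rewrite -/lam.
  rewrite (_ : (s + t) / lam = a k * x * lam ^+ k); last first.
    by rewrite /s /t /a !exprS; field; rewrite gt_eqF.
  have k2 : 0 < 2 ^+ k :> R by rewrite exprn_gt0.
  rewrite -(ler_pM2l k2) => H.
  apply: (le_trans H); rewrite mulrDr mulrA -exprSr lerD2l.
  have := FC t0.
  have -> : t `^ (- alpha) = (r `^ (- alpha)) ^+ k * ((1 - r) / 2) `^ (- alpha)
       * x `^ (- alpha) * 2^-1 ^+ k.+1.
    rewrite /t !powRM ?powR_exprn ?mulr_ge0 ?exprn_ge0 ?(ltW r20) ?(ltW x0) ?(ltW r0) ?(ltW lam0) ?subr_ge0 ?(ltW r1)//.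
    by rewrite [lam `^ _]powRN lamE.
  move=> Ht.
  have : F t ^+ 2 <= (C * ((r `^ (- alpha)) ^+ k * ((1 - r) / 2) `^ (- alpha) *
       x `^ (- alpha) * 2^-1 ^+ k.+1)) ^+ 2.
    by rewrite ler_pXn2r ?nnegrE ?(le_trans (F0 t) Ht).
  rewrite -(ler_pM2l k2) => /le_trans; apply.
  rewrite le_eqVlt; apply/orP; left; apply/eqP.
  have -> : (3 / 4 : R) ^+ k = 2 ^+ k * ((r `^ (- alpha)) ^+ k) ^+ 2 * (2^-1 ^+ k) ^+ 2.
    rewrite -!exprM ![(k * 2)%N]mulnC !exprM rE -!exprMn; congr (_ ^+ k).
    by rewrite expr2; field.
  rewrite /D0 /X [2^-1 ^+ k.+1]exprS.
  move: (2 ^+ k) (2^-1 ^+ k) (r `^ (- alpha) ^+ k) (((1 - r) / 2) `^ (- alpha)) (x `^ (- alpha)).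
  by move=> u1 u2 u3 u4 u5; field.
have sum4 k : \sum_(j < k) (3 / 4 : R) ^+ j <= 4.
  have -> : \sum_(j < k) (3 / 4 : R) ^+ j = 4 * (1 - (3 / 4) ^+ k).
    elim: k => [|k IH]; first by rewrite big_ord0 expr0 subrr mulr0.
    by rewrite big_ord_recr/= IH exprS; field.
  by rewrite ler_piMr// gerBl exprn_ge0//; lra.
apply/ler_addgt0Pr => e e0.
have x20 : 0 < x / 2 by rewrite divr_gt0.
pose e' := e * (x / 2) `^ alpha.
have e'0 : 0 < e' by rewrite mulr_gt0// powR_gt0.
(* The vanishing limit removes the leading term 2^k F(a_k x lam^k): since a_k >= 1/2 and lam^(k
   alpha) = 2^k, it is at most e once x lam^k / 2 is large. *)
have /cvgrPdist_le/(_ e' e'0)[A [_ HA]] := F_lim.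
have [k Hk] : exists k : nat, A < x / 2 * lam ^+ k.
  exists (Num.bound ((`|A| / (x / 2)) `^ alpha)).
  set k := Num.bound _.
  rewrite (le_lt_trans (ler_norm A))// mulrC -ltr_pdivrMr//.
  have -> : lam ^+ k = (2%:R ^+ k) `^ alpha^-1.
    by rewrite powR_exprn.
  have -> : `|A| / (x / 2) = ((`|A| / (x / 2)) `^ alpha) `^ alpha^-1.
    by rewrite powRVK// divr_ge0// ltW.
  rewrite gt0_ltr_powR ?invr_gt0 ?nnegrE ?powR_ge0 ?exprn_ge0//.
  apply: (@lt_le_trans _ _ k%:R).
    exact: archi_boundP (powR_ge0 _ _).
  by rewrite -natrX ler_nat ltnW// ltn_expl.
apply: (le_trans (iter k)); rewrite addrC; apply: lerD.
  by rewrite -[leRHS]mulrA [leRHS]mulrC; apply: ler_wpM2l => //; exact: mulr_ge0.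
have := HA _ Hk; rewrite sub0r normrN => /(le_trans (ler_norm _)).
rewrite powRM ?(ltW x20) ?exprn_ge0 ?(ltW lam0)// -mulrA [e']mulrC ler_pM2l ?powR_gt0//.
apply: le_trans.
have -> : (lam ^+ k) `^ alpha = 2 ^+ k.
  by rewrite powR_exprn ?(ltW lam0)// lamE.
rewrite ler_pM2l ?exprn_gt0//; apply: F_mono.
rewrite ler_pM2r ?exprn_gt0// mulrC ler_pM2r// /a.
by rewrite mulrDl mul1r lerDl divr_ge0 ?exprn_ge0 ?(ltW r0).
Qed.

End tail_iteration.

(** * Second moments: finiteness from tails, and vanishing by scaling *)

Section moments.
Context (R : realType).

Lemma nneseries_le_const (u : nat -> \bar R) (M : \bar R) :
  (forall n, (0 <= u n)%E) ->
  (forall n, (\sum_(0 <= i < n) u i <= M)%E) -> (\sum_(0 <= i <oo) u i <= M)%E.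
Proof.
move=> u0 uM; apply: lime_le; first by apply: is_cvg_nneseries => n _ _.
by apply: nearW => n; exact: uM.
Qed.

Lemma sum_geo_le (a z : R) n : 0 <= a -> 0 <= z -> z < 1 ->
  \sum_(0 <= i < n) a * z ^+ i <= a / (1 - z).
Proof.
move=> a0 z0 z1.
have -> : \sum_(0 <= i < n) a * z ^+ i = a / (1 - z) * (1 - z ^+ n).
  elim: n => [|n IH]; first by rewrite big_nil expr0 subrr mulr0.
  by rewrite big_nat_recr//= IH exprS; field; rewrite subr_eq0 gt_eqF.
by rewrite ler_piMr ?divr_ge0 ?subr_ge0 ?(ltW z1)// gerBl exprn_ge0.
Qed.

(** Dyadic layers: X^2 is at most 1 plus the sum of 4^(k+1) over all k with |X| > 2^k. The tail
    bound makes the expected sum geometric with ratio 4 2^(-g), and this is below 1 because g >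
    2. *)
Lemma second_moment_lty d (T : measurableType d) (P : probability T R)
    (X : {mfun T >-> R}) (C g : R) : 2 < g ->
  (forall x, 0 < x -> pr P [set w | x < `|X w|] <= C * x `^ (- g)) ->
  (\int[P]_w (X w ^+ 2)%:E < +oo)%E.
Proof.
move=> g2 HX.
have mabs : measurable_fun setT (fun w => `|X w|) by exact: measurableT_comp.
pose E k := [set w | 2 ^+ k < `|X w|].
have mE k : measurable (E k) by exact: measurable_gt_set.
pose f k w : \bar R := (4 ^+ k.+1 * \1_(E k) w)%:E.
have f0 k w : (0 <= f k w)%E by rewrite lee_fin mulr_ge0 ?exprn_ge0.
have mf k : measurable_fun setT (f k).
  by apply/measurable_EFinP; apply: measurable_funM => //; exact: measurable_indic.
have intf k : (\int[P]_w f k w = (4 ^+ k.+1 * pr P (E k))%:E)%E.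
  under eq_integral do rewrite /f EFinM.
  rewrite ge0_integralZl//.
  - rewrite integral_indic// setIT EFinM; congr (_ * _)%E; exact: prE.
  - exact/measurable_EFinP/measurable_indic.
pose z : R := 4 * 2 `^ (- g).
have z0 : 0 <= z by rewrite mulr_ge0 ?powR_ge0.
have z1 : z < 1.
  rewrite /z powRN ltr_pdivrMr ?powR_gt0// mul1r.
  have -> : 4 = 2 `^ 2%:R :> R by rewrite powR_mulrn//; ring.
  by rewrite /powR gt_eqF// ltr_expR ltr_pM2r// ln_gt0// ltr1n.
have C0 : 0 <= C by have := HX 1 ltr01; rewrite one_powR mulr1; apply: le_trans; exact: pr_ge0.
apply: (@le_lt_trans _ _ (1%E + \sum_(0 <= k <oo) (\int[P]_w f k w))%E); last first.
  rewrite lte_add_pinfty ?ltry//.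
  apply: (@le_lt_trans _ _ (4 * C / (1 - z))%:E); last by rewrite ltry.
  apply: nneseries_le_const => [k|n]; first by apply: integral_ge0.
  apply: (@le_trans _ _ (\sum_(0 <= k < n) (4 * C * z ^+ k)%:E)%E).
    apply: lee_sum => k _; rewrite intf lee_fin exprS -!mulrA ler_pM2l//.
    rewrite /z exprMn mulrCA ler_pM2l ?exprn_gt0//.
    by rewrite -powR_exprn// HX// exprn_gt0.
  by rewrite sumEFin lee_fin sum_geo_le// mulr_ge0.
rewrite -integral_nneseries//.
rewrite (_ : 1%E = \int[P]_w (1 : R)%:E)%E; last first.
  by rewrite integral_cst//= mul1e probability_setT.
rewrite -ge0_integralD//.
- apply: ge0_le_integral => //.
  + by move=> w _; rewrite lee_fin sqr_ge0.
  + by apply/measurable_EFinP; exact: measurable_funX.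
  + apply: emeasurable_funD => //.
    by apply: ge0_emeasurable_sum.
  + move=> w _.
    have [X1|X1] := leP `|X w| 1.
      apply: (@le_trans _ _ 1%E); last by rewrite leeDl// nneseries_ge0.
      by rewrite lee_fin -(real_normK (num_real (X w))) exprn_ile1.
    have [j Hj] : exists j, `|X w| <= 2 ^+ j.
      exists (Num.bound `|X w|); apply: ltW.
      apply: (lt_le_trans (archi_boundP (normr_ge0 _))).
      by rewrite -natrX ler_nat ltnW// ltn_expl.
    have exj : exists j, `|X w| <= 2 ^+ j by exists j.
    case: (ex_minnP exj) => -[|k] Hk Hmin; first by move: Hk; rewrite expr0 leNgt X1.
    have Ek : E k w.
      by rewrite /E/= ltNge; apply/negP => /Hmin; rewrite ltnn.
    apply: (@le_trans _ _ (f k w)).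
      rewrite lee_fin indicE mem_set// mulr1 -(real_normK (num_real (X w))).
      have -> : 4 = 2 ^+ 2 :> R by ring.
      by rewrite exprAC ler_pXn2r ?nnegrE// exprn_ge0.
    apply: (@le_trans _ _ (\sum_(0 <= i < k.+1) f i w)%E).
      by rewrite big_nat_recr//= leeDr// sume_ge0.
    apply: (le_trans (nneseries_lim_ge k.+1 _)) => [n _ _|]; first exact: f0.
    by rewrite leeDr.
- by move=> w _; rewrite nneseries_ge0.
- by apply: ge0_emeasurable_sum.
Qed.

Lemma same_law_integral d (T : measurableType d) (P : probability T R)
    (X : {mfun T >-> R}) d' (T' : measurableType d') (P' : probability T' R)
    (X' : {mfun T' >-> R}) (f : R -> R) :
  same_law P X P' X' -> measurable_fun setT f -> (forall x, 0 <= f x) ->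
  (\int[P]_w (f (X w))%:E = \int[P']_w (f (X' w))%:E)%E.
Proof.
move=> XX' mf f0.
have mf' : measurable_fun setT (EFin \o f) by exact/measurable_EFinP.
have f0' x : (0 <= (EFin \o f) x)%E by rewrite lee_fin.
transitivity (\int[distribution P X]_x (EFin \o f) x)%E.
  by rewrite (ge0_integral_distribution X mf' f0').
transitivity (\int[distribution P' X']_x (EFin \o f) x)%E.
  by apply: eq_measure_integral => A mA _; exact: XX'.
by rewrite (ge0_integral_distribution X' mf' f0').
Qed.

Section additive.
Context d (T : measurableType d) (P : probability T R).

Lemma ge0_exD (f g : T -> R) : measurable_fun setT f -> measurable_fun setT g ->
  (forall w, 0 <= f w) -> (forall w, 0 <= g w) ->
  (\int[P]_w (f w + g w)%:E = \int[P]_w (f w)%:E + \int[P]_w (g w)%:E)%E.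
Proof.
move=> mf mg f0 g0; under eq_integral do rewrite EFinD.
rewrite ge0_integralD//.
- by move=> w _; rewrite lee_fin.
- exact/measurable_EFinP.
- by move=> w _; rewrite lee_fin.
- exact/measurable_EFinP.
Qed.

Lemma ge0_exZ (c : R) (f : T -> R) : measurable_fun setT f -> 0 <= c ->
  (forall w, 0 <= f w) ->
  (\int[P]_w (c * f w)%:E = c%:E * \int[P]_w (f w)%:E)%E.
Proof.
move=> mf c0 f0; under eq_integral do rewrite EFinM.
rewrite ge0_integralZl//.
- exact/measurable_EFinP.
- by move=> w _; rewrite lee_fin.
Qed.

(* Expanding E (X + Y)^2 and E (X + Y) with positive and negative parts keeps
   every integrand nonnegative. *)
Lemma stable_second_moment_eq0 (X Y Z : {mfun T >-> R}) (lam : R) :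
  0 < lam -> lam != 2 -> lam ^+ 2 != 2 -> indep2 P X Y -> same_law P Y P X ->
  (forall w, Z w = X w + Y w) -> same_law P Z P (fun w => lam * X w) ->
  (\int[P]_w (X w ^+ 2)%:E < +oo)%E -> (\int[P]_w (X w ^+ 2)%:E = 0)%E.
Proof.
move=> lam0 lam2 lamsq XY YX ZE ZX fin.
pose p (x : R) := Num.max x 0; pose n (x : R) := Num.max (- x) 0; pose s (x : R) := x ^+ 2.
have mp : measurable_fun setT p by exact: measurable_maxr.
have mn : measurable_fun setT n by apply: measurable_maxr => //; exact: measurableT_comp.
have ms : measurable_fun setT s by exact: measurable_funX.
have p0 x : 0 <= p x by rewrite /p le_max lexx orbT.
have n0 x : 0 <= n x by rewrite /n le_max lexx orbT.
have s0 x : 0 <= s x by exact: sqr_ge0.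
have pm (x : R) : [/\ p x - n x = x, p x * n x = 0, p x <= 1 + s x & n x <= 1 + s x].
  rewrite /p /n /s; case: (leP 0 x) => x0; case: (leP 0 (- x)) => x0'; split; nra.
pose I (f : R -> R) (U : {mfun T >-> R}) := (\int[P]_w (f (U w))%:E)%E.
have YXI (f : R -> R) : measurable_fun setT f -> (forall x, 0 <= f x) -> I f Y = I f X.
  by move=> mf f0; exact: same_law_integral.
pose lX : {mfun T >-> R} := (lam \o* X)%R.
have ZXI (f : R -> R) : measurable_fun setT f -> (forall x, 0 <= f x) -> I f Z = I f lX.
  move=> mf f0; apply: same_law_integral => //.
  apply: same_law_trans ZX _ => B mB; congr (P _).
  by apply/seteqP; split => w /=; rewrite mulrC.
have mU (f : R -> R) (U : {mfun T >-> R}) : measurable_fun setT f ->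
    measurable_fun setT (fun w => f (U w)).
  by move=> mf; exact: measurableT_comp.
have lXI (f : R -> R) : measurable_fun setT f -> (forall x, 0 <= f x) -> forall c, 0 <= c ->
    (forall x, f (lam * x) = c * f x) -> I f lX = (c%:E * I f X)%E.
  move=> mf f0 c c0 fl; rewrite /I -ge0_exZ//; last exact: mU.
  by apply: eq_integral => w _; rewrite /lX/= mulrC fl.
have l0 := ltW lam0.
have fins : I s X \is a fin_num.
  by rewrite ge0_fin_numE//; apply: integral_ge0 => w _; rewrite lee_fin.
have finle (f : R -> R) : measurable_fun setT f -> (forall x, 0 <= f x) ->
    (forall x, f x <= 1 + s x) -> I f X \is a fin_num.
  move=> mf f0 fs; rewrite ge0_fin_numE; last by apply: integral_ge0 => w _; rewrite lee_fin.
  apply: (@le_lt_trans _ _ (\int[P]_w (1 + s (X w))%:E)%E).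
    apply: ge0_le_integral => //.
    - by move=> w _; rewrite lee_fin.
    - exact/measurable_EFinP/mU.
    - by apply/measurable_EFinP; apply: measurable_funD => //; exact: mU.
    - by move=> w _; rewrite lee_fin.
  rewrite ge0_exD//; last exact: mU.
  by rewrite integral_cst//= mul1e probability_setT lte_add_pinfty// ltry.
have finp : I p X \is a fin_num by apply: finle => // x; have [] := pm x.
have finn : I n X \is a fin_num by apply: finle => // x; have [] := pm x.
set a := fine (I p X); set b := fine (I n X); set m := fine (I s X).
have aE : I p X = a%:E by rewrite fineK.
have bE : I n X = b%:E by rewrite fineK.
have mE : I s X = m%:E by rewrite fineK.
have pZ : I p Z = (lam * a)%:E.
  rewrite ZXI// (lXI _ _ _ lam)// ?aE// => x.
  by rewrite /p maxr_pMr// mulr0.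
have nZ : I n Z = (lam * b)%:E.
  rewrite ZXI// (lXI _ _ _ lam)// ?bE// => x.
  by rewrite /n maxr_pMr// mulr0 mulrN.
have sZ : I s Z = (lam ^+ 2 * m)%:E.
  by rewrite ZXI// (lXI _ _ _ (lam ^+ 2)) ?mE ?sqr_ge0// => x; rewrite /s exprMn.
have prod (f g : R -> R) : measurable_fun setT f -> measurable_fun setT g ->
    (forall x, 0 <= f x) -> (forall x, 0 <= g x) ->
    (\int[P]_w (f (X w) * g (Y w))%:E = I f X * I g X)%E.
  by move=> mf mg f0 g0; rewrite (indep2_expectation_mul XY)// -/(I g Y) YXI.
have mXY (f g : R -> R) : measurable_fun setT f -> measurable_fun setT g ->
    measurable_fun setT (fun w => f (X w) * g (Y w)).
  by move=> mf mg; apply: measurable_funM; exact: mU.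
have mUV (f g : R -> R) (U V : {mfun T >-> R}) :
    measurable_fun setT f -> measurable_fun setT g ->
    measurable_fun setT (fun w => f (U w) + g (V w)).
  by move=> mf mg; apply: measurable_funD; exact: mU.
(* This is E Z = 2 E X rearranged so that nothing is subtracted. As E Z = lam E X and lam <> 2, the
   mean a - b is 0. *)
have first : lam * a + b + b = lam * b + a + a.
  have : (\int[P]_w (p (Z w) + n (X w) + n (Y w))%:E =
      \int[P]_w (n (Z w) + p (X w) + p (Y w))%:E)%E.
    apply: eq_integral => w _; congr EFin; rewrite ZE.
    have [h1 _ _ _] := pm (X w + Y w); have [h2 _ _ _] := pm (X w).
    have [h3 _ _ _] := pm (Y w); lra.
  rewrite !ge0_exD //; try exact: mU; try exact: mUV; try by move=> w; rewrite addr_ge0.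
  rewrite -!/(I _ _) pZ nZ (YXI n)// (YXI p)// aE bE -!EFinD.
  by move=> [].
have ab : a = b.
  have : (a - b) * (lam - 2) = 0 by lra.
  by move/eqP; rewrite mulf_eq0 !subr_eq0 (negbTE lam2) orbF => /eqP.
(* This is E Z^2 = E X^2 + E Y^2 + 2 E X E Y with the negative cross terms moved to the left. For a
   = b it reduces to lam^2 m = 2 m. *)
have second : lam ^+ 2 * m + (2 * (a * b) + 2 * (b * a)) =
    m + m + (2 * (a * a) + 2 * (b * b)).
  have : (\int[P]_w (s (Z w) + (2 * (p (X w) * n (Y w)) + 2 * (n (X w) * p (Y w))))%:E =
      \int[P]_w (s (X w) + s (Y w) + (2 * (p (X w) * p (Y w)) + 2 * (n (X w) * n (Y w))))%:E)%E.
    apply: eq_integral => w _; congr EFin; rewrite ZE /s.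
    have [h2 _ _ _] := pm (X w); have [h3 _ _ _] := pm (Y w).
    move: h2 h3; move: (p (X w)) (n (X w)) (p (Y w)) (n (Y w)) => px nx py ny <- <-.
    by ring.
  have exZ2 (f g : R -> R) : measurable_fun setT f -> measurable_fun setT g ->
      (forall x, 0 <= f x) -> (forall x, 0 <= g x) ->
      (\int[P]_w (2 * (f (X w) * g (Y w)))%:E = 2%:E * (I f X * I g X))%E.
    move=> mf mg f0 g0; rewrite ge0_exZ ?prod//; first exact: mXY.
    by move=> w; rewrite mulr_ge0.
  have mXY2 (f g : R -> R) : measurable_fun setT f -> measurable_fun setT g ->
      measurable_fun setT (fun w => 2 * (f (X w) * g (Y w))).
    by move=> mf mg; apply: measurable_funM => //; exact: mXY.
  have ge2 (f g : R -> R) w : (forall x, 0 <= f x) -> (forall x, 0 <= g x) ->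
      0 <= 2 * (f (X w) * g (Y w)).
    by move=> f0 g0; rewrite !mulr_ge0.
  have mXYD (f g h k : R -> R) : measurable_fun setT f -> measurable_fun setT g ->
      measurable_fun setT h -> measurable_fun setT k ->
      measurable_fun setT (fun w => 2 * (f (X w) * g (Y w)) + 2 * (h (X w) * k (Y w))).
    by move=> mf mg mh mk; apply: measurable_funD; exact: mXY2.
  rewrite !ge0_exD //; try exact: mU; try exact: mUV; try exact: mXY2; try exact: mXYD;
    try by move=> w; rewrite ?addr_ge0 ?ge2.
  rewrite !exZ2// -/(I s Z) -/(I s X) -/(I s Y) (YXI s)// sZ mE aE bE -!EFinM -!EFinD.
  by move=> [].
have : m * (lam ^+ 2 - 2) = 0 by move: second; rewrite ab; lra.
move/eqP; rewrite mulf_eq0 subr_eq0 (negbTE lamsq) orbF => /eqP m0.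
by rewrite -/(s _) -/(I s X) mE m0.
Qed.

End additive.
End moments.

(** * The two tail constants and the positivity of their sum *)

Section walk_tails.
Context (R : realType).

Lemma mutually_independent_comp d (T : measurableType d) (P : probability T R)
    (I : choiceType) (X : I -> T -> R) (g : I -> R -> R) :
  (forall i, measurable_fun setT (g i)) ->
  mutually_independent P X -> mutually_independent P (fun i => g i \o X i).
Proof.
move=> mg indX s B us mB; apply: (indX s (fun i => g i @^-1` B i)) => // i.
by rewrite -[X in measurable X]setTI; exact: mg.
Qed.

Lemma stable_walk_opp (alpha : R) d (T : measurableType d) (P : probability T R)
    (W : nat -> {mfun T >-> R}) :
  stable_walk alpha P W -> stable_walk alpha P (fun n => (\- W n)%R).
Proof.
move=> [W0 ind law].
have mN : measurable_fun setT (-%R : R -> R) by exact: oppr_measurable.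
have NE s t w : (\- W t)%R w - (\- W s)%R w = - (W t w - W s w).
  by rewrite /= opprB opprK addrC.
split => [w|t ht|s t st].
- by rewrite /= W0 oppr0.
- have := mutually_independent_comp (fun=> mN) (ind t ht); congr (mutually_independent _ _).
  by apply/funext => i; apply/funext => w; rewrite /= opprK opprB addrC.
- have -> : (fun w => (\- W t)%R w - (\- W s)%R w) = -%R \o (fun w => W t w - W s w).
    by apply/funext => w; rewrite NE.
  have -> : (fun w => (t - s)%:R `^ alpha^-1 * (\- W 1%N)%R w) =
      -%R \o (fun w => (t - s)%:R `^ alpha^-1 * W 1%N w).
    by apply/funext => w; rewrite /= mulrN.
  exact: same_law_comp1 (law s t st).
Qed.

Context (alpha : R) (halpha : 1 < alpha < 2).
Context d (T : measurableType d) (P : probability T R) (W : nat -> {mfun T >-> R}).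
Hypothesis hW : stable_walk alpha P W.

Lemma walk_tails : ~ {ae P, forall w, W 1%N w = 0} ->
  exists cp cm : R, [/\ 0 <= cp, 0 <= cm, 0 < cp + cm,
    x `^ alpha * tailp P W x @[x --> +oo] --> cp &
    x `^ alpha * tailp P (fun n => (\- W n)%R) x @[x --> +oo] --> cm].
Proof.
move=> nd; have /andP[a1 a2] := halpha.
have a0 : 0 < alpha by exact: lt_trans a1.
have hN := stable_walk_opp hW.
have [cp cp0 hcp] := tailp_cvg a0 hW.
have [cm cm0 hcm] := tailp_cvg a0 hN.
exists cp, cm; split => //.
rewrite lt_neqAle addr_ge0// andbT eq_sym paddr_eq0//.
apply/negP => /andP[/eqP cp_eq0 /eqP cm_eq0]; apply: nd.
rewrite cp_eq0 in hcp; rewrite cm_eq0 in hcm.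
have [C C0 HC] := tailp_bound a0 hW.
have [C' C'0 HC'] := tailp_bound a0 hN.
have [D HD] := tail_improvement a0 (tailp_ge0 P W) (@tailp_mono _ _ _ P W)
  HC (tailp_split hW) hcp.
have [D' HD'] := tail_improvement a0 (tailp_ge0 P _) (@tailp_mono _ _ _ P _)
  HC' (tailp_split hN) hcm.
have fin : (\int[P]_w (W 1%N w ^+ 2)%:E < +oo)%E.
  apply: (@second_moment_lty _ _ _ P (W 1%N) (D + D') (2 * alpha)).
    by rewrite ltr_pMr.
  move=> x x0; rewrite mulrDl; apply: le_trans (lerD (HD x x0) (HD' x x0)).
  have -> : [set w | x < `|W 1%N w|] =
      [set w | x < W 1%N w] `|` [set w | x < (\- W 1%N)%R w].
    apply/seteqP; split => w /=; rewrite ltr_normr => /orP; exact.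
  by apply: prU_le; exact: measurable_gt_set.
have [W0 ind law] := hW.
pose X : {mfun T >-> R} := (W 1%N \- W 0%N)%R.
pose Y : {mfun T >-> R} := (W 2%N \- W 1%N)%R.
pose Z : {mfun T >-> R} := (W 2%N \- W 0%N)%R.
have XE : X = W 1%N :> (T -> R) by apply/funext => w; rewrite /X/= W0 subr0.
have lawX s t : (s < t)%N ->
    same_law P (fun w => W t w - W s w) P (fun w => (t - s)%:R `^ alpha^-1 * X w).
  by rewrite XE; exact: law.
have int0 : (\int[P]_w (X w ^+ 2)%:E = 0)%E.
  (* The scaling factor 2^(1/alpha) is below 2 since alpha > 1, and its square exceeds 2 since alpha
     < 2. *)
  apply: (@stable_second_moment_eq0 _ _ _ P X Y Z (2%:R `^ alpha^-1)).
  - by rewrite powR_gt0.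
  - rewrite lt_eqF// -[ltRHS]powRr1//.
    by rewrite /powR gt_eqF// ltr_expR ltr_pM2r ?ln_gt0 ?ltr1n// invf_lt1.
  - rewrite gt_eqF// -powR_mulrn ?powR_ge0// -powRrM -[ltLHS]powRr1//.
    rewrite /powR gt_eqF// ltr_expR ltr_pM2r ?ln_gt0 ?ltr1n//.
    by rewrite mulrC ltr_pdivlMr// mul1r.
  - exact: walk_indep2 hW.
  - apply: same_law_trans (lawX 1%N 2%N isT) _ => B mB.
    by congr (P _); apply/seteqP; split => w /=; rewrite one_powR mul1r.
  - by move=> w; rewrite /X /Y /Z/=; ring.
  - exact: lawX.
  - by under eq_integral do rewrite XE.
have mX2 : measurable_fun setT (fun w => (X w ^+ 2)%:E).
  by apply/measurable_EFinP; exact: measurable_funX.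
have [H _] := ae_eq_integral_abs P measurableT mX2.
have : ae_eq P setT (fun w => (X w ^+ 2)%:E) (cst 0%E).
  apply: H; under eq_integral do rewrite gee0_abs ?lee_fin ?sqr_ge0//.
  exact: int0.
apply: filterS => w /(_ I) /= [] /eqP.
by rewrite sqrf_eq0 W0 subr0 => /eqP.
Qed.

End walk_tails.

(** * Centering a stable process *)

Section law_shift.
Context (R : realType).

(** Otherwise x -> P(U > x) would have the period c' - c, although it tends to 0 at +oo and to 1 at
    -oo. *)
Lemma same_law_shift_inj d (T : measurableType d) (P : probability T R)
    (U : {mfun T >-> R}) (c c' : R) :
  same_law P (fun w => U w + c) P (fun w => U w + c') -> c = c'.
Proof.
wlog cc' : c c' / c < c'.
  move=> wl h; have [cc|cc|//] := ltgtP c c'; first exact: (wl _ _ cc h).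
  exact: (esym (wl _ _ cc (same_law_sym h))).
move=> h; exfalso.
pose F x := pr P [set w | x < U w].
have dl0 : 0 < c' - c by rewrite subr_gt0.
have step x : F (x + (c' - c)) = F x.
  have := h _ (measurable_itv `]x + c', +oo[).
  have eqp (z y : R) : (fun w => U w + z) @^-1` `]y, +oo[ = [set w | y - z < U w].
    by apply/seteqP; split => w /=; rewrite in_itv/= andbT ltrBlDr.
  rewrite !eqp addrK -addrA /F /pr => ->; congr (fine (P _)).
have steps n x : F (x + n%:R * (c' - c)) = F x.
  elim: n => [|n IH]; first by rewrite mul0r addr0.
  by rewrite -natr1 mulrDl mul1r addrA step.
have e4 : 0 < 1 / 4 :> R by lra.
have [A A0 HA] := tailp_cvg0 P (fun=> U) e4.
have [B B0 /(_ B (lexx _)) HB] := lower_cvg1 P (fun=> U) e4.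
pose n := Num.bound ((A + B) / (c' - c)).
have : A <= - B + n%:R * (c' - c).
  rewrite addrC lerBrDr -ler_pdivrMr//.
  apply: ltW; apply: archi_boundP.
  exact: divr_ge0 (addr_ge0 (ltW A0) (ltW B0)) (ltW dl0).
by move/HA; rewrite /tailp -/(F _) steps; move: HB; rewrite -/(F _); lra.
Qed.

End law_shift.

Section centering.
Context (R : realType) (alpha : R) (halpha : 1 < alpha < 2).
Context d (T : measurableType d) (P : probability T R) (S : R -> {RV P >-> R}).
Hypothesis hS : stable_process alpha S.

Local Notation rt n := (n%:R `^ alpha^-1).

(** Subtracting [S 0], which is 0 only almost surely, makes the walk start at 0 for every
    outcome. *)
Let Y (n : nat) : {mfun T >-> R} := (S n%:R \- S 0)%R.

Let incr_law (s t : nat) : (s <= t)%N ->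
  same_law P (fun w => S t%:R w - S s%:R w) P (S (t - s)%:R).
Proof.
move=> st; have [[_ _ stat _] _ _] := hS.
have := stat s%:R (t - s)%:R (ler0n _ _) (ler0n _ _).
by rewrite -natrD subnKC.
Qed.

Let Y_law (n : nat) : same_law P (Y n) P (S n%:R).
Proof. by have := incr_law (leq0n n); rewrite subn0. Qed.

Let incr_ind (t : nat -> nat) : (forall i, (t i <= t i.+1)%N) ->
  mutually_independent P (fun i w => S (t i.+1)%:R w - S (t i)%:R w).
Proof.
move=> tm; have [[_ ind _ _] _ _] := hS.
by apply: (ind (fun i => (t i)%:R)) => [|i]; [exact: ler0n|rewrite ler_nat].
Qed.

Let Y_ind (m n : nat) : (m <= n)%N ->
  indep2 P (Y m) (fun w => S n%:R w - S m%:R w).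
Proof.
move=> mn.
have tm k : (nth n [:: 0; m]%N k <= nth n [:: 0; m]%N k.+1)%N.
  by case: k => [|[|k]] //=; rewrite nth_nil.
exact: (mutually_independent2 (incr_ind tm) (_ : 0%N != 1%N)).
Qed.

(** Over n m steps the process is a sum of n independent blocks, each with the law of m^(1/alpha)
    S_1 + c, and n independent copies of S_1 add up to [Y n] in law. *)
Let Y_addlaw (n m : nat) (c : R) :
  (same_law P (S m%:R) P (fun w => rt m * S 1 w + c)) ->
  same_law P (Y (n * m)) P (fun w => rt m * Y n w + n%:R * c).
Proof.
move=> hc; elim: n => [|n IH].
  have -> : (fun w => rt m * Y 0 w + 0%:R * c) = Y (0 * m)%N.
    by apply/funext => w; rewrite /Y/= mul0n mul0r addr0 subrr mulr0.
  by move=> B mB.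
have mle : (n * m <= n.+1 * m)%N by rewrite mulSn leq_addl.
have -> : Y (n.+1 * m) = (fun w => Y (n * m) w + (S (n.+1 * m)%:R \- S (n * m)%:R)%R w) :> (T -> R).
  by apply/funext => w; rewrite /Y/=; ring.
pose A : {mfun T >-> R} := (S (n.+1 * m)%:R \- S (n * m)%:R)%R.
pose B : {mfun T >-> R} := (S n.+1%:R \- S n%:R)%R.
pose f (x : R) := rt m * x + n%:R * c.
pose g (x : R) := rt m * x + c.
have maff (u v : R) : measurable_fun setT (fun x : R => u * x + v).
  by apply: measurable_funD => //; exact: measurable_funM.
have [A' A'E] := mfun_of_measurable (measurableT_comp (maff (rt m) (n%:R * c)) (measurable_funPT (Y n))).
have [B' B'E] := mfun_of_measurable (measurableT_comp (maff (rt m) c) (measurable_funPT B)).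
have -> : (fun w => rt m * Y n.+1 w + n.+1%:R * c) = (fun w => A' w + B' w).
  apply/funext => w; rewrite A'E B'E /Y /B/=; ring.
apply: (@same_law_comp _ _ _ P (Y (n * m)) A _ _ P A' B' _ _ _ _ (fun p => p.1 + p.2)).
- exact: Y_ind.
- by rewrite A'E B'E; apply: indep2_comp (Y_ind (leqnSn n)).
- by rewrite A'E.
- rewrite B'E; apply: (same_law_trans (incr_law mle)).
  rewrite mulSn addnK; apply: (same_law_trans hc).
  apply: (same_law_comp1 (maff (rt m) c)).
  by apply: same_law_sym; have := incr_law (leqnSn n); rewrite subSnn.
- exact: measurable_funD.
Qed.

Let rt2 : 2 - rt 2 != 0 :> R.
Proof.
have /andP[a1 _] := halpha; have a0 : 0 < alpha by exact: lt_trans a1.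
rewrite subr_eq0 gt_eqF// -[ltRHS]powRr1//.
by rewrite /powR gt_eqF// ltr_expR ltr_pM2r ?ln_gt0 ?ltr1n// invf_lt1.
Qed.

(* Computing the law of S (2 n) from n blocks of length 2 and from 2 blocks of
   length n shows that the centering constants are b (n - n^(1/alpha)). *)
Lemma centering_constant : exists b : R, forall n : nat, (0 < n)%N ->
  same_law P (S n%:R) P (fun w => rt n * S 1 w + b * (n%:R - rt n)).
Proof.
have [_ stab _] := hS.
have [c2 hc2] := stab 2%:R (ltr0n _ _).
(* The two decompositions give 2^(1/alpha) c + n c2 = n^(1/alpha) c2 + 2 c, which is solved for c;
   the denominator is nonzero because alpha > 1. *)
exists (c2 / (2 - rt 2)) => n n0.
have n0' : 0 < n%:R :> R by rewrite ltr0n.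
have [c hc] := stab n%:R n0'.
suff -> : c2 / (2 - rt 2) * (n%:R - rt n) = c by [].
have maff (u v : R) : measurable_fun setT (fun x : R => u * x + v).
  by apply: measurable_funD => //; exact: measurable_funM.
have Y1 (m : nat) (e : R) : same_law P (S m%:R) P (fun w => rt m * S 1 w + e) ->
    same_law P (Y m) P (fun w => rt m * Y 1%N w + e).
  move=> he; apply: (same_law_trans (@Y_law m)); apply: (same_law_trans he).
  by apply: (same_law_comp1 (maff (rt m) e)); apply: same_law_sym; exact: Y_law.
have k1 := same_law_trans (Y_addlaw n hc2)
  (same_law_comp1 (maff (rt 2) (n%:R * c2)) (Y1 _ _ hc)).
have k2 := same_law_trans (Y_addlaw 2 hc)
  (same_law_comp1 (maff (rt n) (2%:R * c)) (Y1 _ _ hc2)).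
rewrite mulnC in k2.
have k := same_law_trans (same_law_sym k1) k2.
have [U UE] := mfun_of_measurable (measurable_funM (measurable_cst (rt 2 * rt n : R)) (measurable_funPT (Y 1%N))).
have e1 : (fun x => rt 2 * x + n%:R * c2) \o (fun w => rt n * Y 1%N w + c) =
    (fun w => U w + (rt 2 * c + n%:R * c2)).
  by apply/funext => w; rewrite UE /=; ring.
have e2 : (fun x => rt n * x + 2%:R * c) \o (fun w => rt 2 * Y 1%N w + c2) =
    (fun w => U w + (rt n * c2 + 2 * c)).
  by apply/funext => w; rewrite UE /=; ring.
rewrite e1 e2 in k.
have e := same_law_shift_inj k.
apply: (mulfI rt2); rewrite mulrA mulrCA mulfV// mulr1; lra.
Qed.

(** With centering constants b (n - n^(1/alpha)), S_n - b n has the law of n^(1/alpha) (S_1 - b):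
    removing the drift b n leaves no centering term. *)
Lemma stable_walk_of_process : exists (b : R) (W : nat -> {mfun T >-> R}),
  [/\ stable_walk alpha P W, ~ {ae P, forall w, W 1%N w = 0} &
      same_law P (fun w => W 1%N w + b) P (S 1)].
Proof.
have [b hb] := centering_constant.
have [[S0 _ _ _] _ nd] := hS.
pose W n : {mfun T >-> R} := (Y n \- cst (b * n%:R))%R.
have mB (c : R) : measurable_fun setT (fun x : R => x - c) by exact: measurable_funB.
have mD (c : R) : measurable_fun setT (fun x : R => x + c) by exact: measurable_funD.
have maff (u v : R) : measurable_fun setT (fun x : R => u * x + v).
  by apply: measurable_funD => //; exact: measurable_funM.
have W1 : same_law P (fun w => W 1%N w + b) P (S 1).
  have -> : (fun w => W 1%N w + b) = Y 1%N.
    by apply/funext => w; rewrite /W/=; ring.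
  exact: Y_law.
exists b, W; split => //.
- split => [w|t tm|s t st].
  + by rewrite /W /Y/= subrr mulr0 subr0.
  + have := mutually_independent_comp
      (fun i => mB (b * ((t i.+1)%:R - (t i)%:R))) (incr_ind tm).
    congr (mutually_independent _ _).
    by apply/funext => i; apply/funext => w; rewrite /W /Y/=; ring.
  + have ts : (0 < t - s)%N by rewrite subn_gt0.
    have -> : (fun w => W t w - W s w) =
        (fun x => x - b * (t - s)%:R) \o (fun w => S t%:R w - S s%:R w).
      apply/funext => w; rewrite /W /Y/= natrB ?(ltnW st)//; ring.
    have -> : (fun w => (t - s)%:R `^ alpha^-1 * W 1%N w) =
        (fun x => rt (t - s) * x + (- (rt (t - s) * b))) \o (Y 1%N).
      by apply/funext => w; rewrite /W /=; ring.
    apply: (same_law_trans (same_law_comp1 (mB _) (incr_law (ltnW st)))).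
    apply: (same_law_trans (same_law_comp1 (mB _) (hb _ ts))).
    have -> : (fun x => x - b * (t - s)%:R) \o
          (fun w => rt (t - s) * S 1 w + b * ((t - s)%:R - rt (t - s))) =
        (fun x => rt (t - s) * x + (- (rt (t - s) * b))) \o (S 1).
      by apply/funext => w /=; ring.
    by apply: (same_law_comp1 (maff _ _)); apply: same_law_sym; exact: Y_law.
- move=> W10; apply: nd; exists b.
  apply: filterS2 W10 S0 => w hW hS0.
  have {hW} : S 1 w - S 0 w - b * 1 = 0 by exact: hW.
  by rewrite hS0 subr0 mulr1 => /eqP; rewrite subr_eq0 => /eqP.
Qed.

End centering.

(** * Weighted sums of heavy-tailed variables *)

Lemma bigU_ordP (T : Type) (E : nat -> set T) N x :
  (\big[setU/set0]_(i < N) E i) x <-> exists2 i, (i < N)%N & E i x.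
Proof. by rewrite -bigcup_mkord; split => -[i]; exists i. Qed.

Lemma geo_small (R : realType) (q K k : R) : 0 <= q < 1 -> 0 < k ->
  exists2 N, (0 < N)%N & K * q ^+ N <= k.
Proof.
move=> /andP[q0 q1] k0.
have : K * q ^+ n @[n --> \oo] --> K * 0.
  by apply: cvgM; [exact: cvg_cst|apply: cvg_expr; rewrite ger0_norm].
rewrite mulr0 => /cvgrPdist_le/(_ k k0)[N _ HN].
exists N.+1 => //; have := HN N.+1 (leqnSn N).
by rewrite /= sub0r normrN => /(le_trans (ler_norm _)).
Qed.

Lemma powRN_small (R : realType) (b K k : R) : 0 < b -> 0 <= K -> 0 < k ->
  exists2 u0, 0 < u0 & forall u, u0 <= u -> K * u `^ (- b) <= k.
Proof.
move=> b0 K0 k0; pose v := K / k + 1.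
have v0 : 0 < v by rewrite ltr_wpDl// divr_ge0// ltW.
exists (v `^ b^-1); first by rewrite powR_gt0.
move=> u vu; have u0 : 0 < u by apply: lt_le_trans vu; rewrite powR_gt0.
rewrite powRN ler_pdivrMr ?powR_gt0// mulrC -ler_pdivrMr//.
apply: (@le_trans _ _ v); first by rewrite lerDl.
rewrite -[leLHS]powRr1 ?(ltW v0)// -(@mulVf _ b) ?gt_eqF// powRrM.
by rewrite ge0_ler_powR ?nnegrE ?powR_ge0 ?(ltW b0) ?(ltW u0).
Qed.

(** Error budget of the upper bound: [x] stands for the single jumps, [y] for the double jumps, and
    the last [k] on the left for the terms of index at least N. *)
Lemma wsum_upper_arith (R : realFieldType) (k c A x y : R) :
  x <= (1 + k) * (c + k) * A -> y <= k -> k * k * A <= k * A ->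
  x + y + k <= c * A + k * ((c + 2) * A + 2).
Proof.
move=> h1 h2 h3.
have : (1 + k) * (c + k) * A = c * A + k * A + k * (c * A) + k * k * A by ring.
have : k * ((c + 2) * A + 2) = k * (c * A) + 2 * (k * A) + 2 * k by ring.
lra.
Qed.

Section weighted_sum.
Context (R : realType) d (T : measurableType d) (P : probability T R).
Context (Z w : nat -> {mfun T >-> R}) (G : R -> R) (e : nat -> R) (b : R).
Hypothesis b0 : 0 < b.
Hypothesis Z0 : forall n x, 0 <= Z n x.
Hypothesis w01 : forall n x, 0 <= w n x <= 1.
Hypothesis wZ : forall n, indep2 P (w n) (Z n).
Hypothesis ZZ : forall i j, i != j -> indep2 P (Z i) (Z j).
Hypothesis ZG : forall n x, pr P [set o | x < Z n o] = G x.
Hypothesis we : forall n, (\int[P]_o (w n o `^ b)%:E = (e n)%:E)%E.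

Definition jump n x := [set o | x < w n o * Z n o].

Lemma measurable_jump n x : measurable (jump n x).
Proof. by apply: measurable_gt_set; exact: measurable_funM. Qed.

Lemma G_ge0 x : 0 <= G x.
Proof. by rewrite -(ZG 0) pr_ge0. Qed.

Lemma G_le1 x : G x <= 1.
Proof. by rewrite -(ZG 0) pr_le1//; exact: measurable_gt_set. Qed.

Let mprod_gt t : measurable [set p : R * R | t < p.1 * p.2].
Proof.
have mf : measurable_fun setT (fun p : R * R => p.1 * p.2) by exact: measurable_funM.
have -> : [set p : R * R | t < p.1 * p.2] = (fun p : R * R => p.1 * p.2) @^-1` `]t, +oo[.
  by apply/seteqP; split => p /=; rewrite in_itv/= andbT.
by rewrite -[X in measurable X]setTI; exact: mf.
Qed.

Let pr_jump n t :
  (pr P (jump n t))%:E = (\int[P]_o P [set o' | (t < w n o * Z n o')%R])%E.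
Proof.
by rewrite -prE; [exact: (joint_law_integral (wZ n) (mprod_gt t))|exact: measurable_jump].
Qed.

Let mcond n t : measurable_fun setT (fun o => P [set o' | (t < w n o * Z n o')%R]).
Proof.
have mx := measurable_fun_xsection (distribution P (Z n)) (mprod_gt t).
have -> : (fun o => P [set o' | (t < w n o * Z n o')%R]) =
    (distribution P (Z n) \o xsection [set p : R * R | t < p.1 * p.2]) \o w n.
  apply/funext => o /=; rewrite /distribution /pushforward; congr (P _).
  by apply/seteqP; split => o' /=; rewrite /xsection/= inE.
exact: measurableT_comp mx (measurable_funPT (w n)).
Qed.

Let pr_scaled n (v t : R) : 0 <= v -> 0 < t ->
  pr P [set o | t < v * Z n o] = if v == 0 then 0 else G (t / v).
Proof.
move=> v0 t0; case: eqVneq => [->|vn0].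
  rewrite (_ : [set o | _] = set0) ?pr0//.
  by apply/seteqP; split => o //=; rewrite mul0r ltNge ltW.
have vp : 0 < v by rewrite lt_neqAle eq_sym vn0.
rewrite -(ZG n); congr (pr P _).
by apply/seteqP; split => o /=; rewrite ltr_pdivrMr// mulrC.
Qed.

Let msec n v t : measurable [set o | (t < v * Z n o)%R].
Proof. by apply: measurable_gt_set; exact: measurable_funM. Qed.

Let mwb n : measurable_fun setT (fun o => w n o `^ b).
Proof. exact: measurableT_comp (measurable_powR b) (measurable_funPT (w n)). Qed.

Let powRdivN (t v : R) : 0 < t -> 0 < v -> (t / v) `^ (- b) = t `^ (- b) * v `^ b.
Proof.
move=> t0 v0; rewrite powRM ?invr_ge0 ?ltW//; congr (_ * _).
by rewrite -powR_inv1 ?ltW// -powRrM mulN1r opprK.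
Qed.

(** Given the weight v > 0, the term exceeds t with probability G(t / v) <= k t^(-b) v^b, and
    integrating v^b gives e_n. As v <= 1, the level t / v never falls below t, so the bound on G is
    needed from t on only. A zero weight contributes 0 on both sides. *)
Lemma jump_le n (k t : R) : 0 < t -> 0 <= k ->
  (forall z, t <= z -> G z <= k * z `^ (- b)) ->
  pr P (jump n t) <= k * t `^ (- b) * e n.
Proof.
move=> t0 k0 H; rewrite -lee_fin pr_jump EFinM -we -ge0_exZ//; last 2 first.
- by rewrite mulr_ge0 ?powR_ge0.
- by move=> o; exact: powR_ge0.
apply: ge0_le_integral => //.
- by apply/measurable_EFinP; apply: measurable_funM.
- move=> o _; rewrite prE// lee_fin; have /andP[v0 v1] := w01 n o.
  rewrite pr_scaled//; case: eqVneq => [->|vn0].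
    by rewrite powR0 ?gt_eqF// mulr0.
  have vp : 0 < w n o by rewrite lt_neqAle eq_sym vn0.
  by rewrite -mulrA -powRdivN// H// ler_pdivlMr// ler_piMr// ltW.
Qed.

Lemma jump_ge n (k t : R) : 0 < t -> 0 <= k ->
  (forall z, t <= z -> k * z `^ (- b) <= G z) ->
  k * t `^ (- b) * e n <= pr P (jump n t).
Proof.
move=> t0 k0 H; rewrite -lee_fin pr_jump EFinM -we -ge0_exZ//; last 2 first.
- by rewrite mulr_ge0 ?powR_ge0.
- by move=> o; exact: powR_ge0.
apply: ge0_le_integral => //.
- by move=> o _; rewrite lee_fin !mulr_ge0 ?powR_ge0.
- by apply/measurable_EFinP; apply: measurable_funM.
- move=> o _; rewrite prE// lee_fin; have /andP[v0 v1] := w01 n o.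
  rewrite pr_scaled//; case: eqVneq => [->|vn0].
    by rewrite powR0 ?gt_eqF// mulr0.
  have vp : 0 < w n o by rewrite lt_neqAle eq_sym vn0.
  by rewrite -mulrA -powRdivN// H// ler_pdivlMr// ler_piMr// ltW.
Qed.

Definition wsum (o : T) : \bar R := (\sum_(0 <= n <oo) (w n o * Z n o)%:E)%E.

Let wZ0 n o : 0 <= w n o * Z n o.
Proof. by rewrite mulr_ge0//; have /andP[] := w01 n o. Qed.

Lemma measurable_wsum_gt u : measurable [set o | (u%:E < wsum o)%E].
Proof.
have mS : measurable_fun setT wsum.
  apply: ge0_emeasurable_sum => k *; first by rewrite lee_fin.
  by apply/measurable_EFinP; exact: measurable_funM.
by rewrite -[X in measurable X]setTI; exact: emeasurable_fun_o_infty.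
Qed.

Let both i j x := [set o | x < Z i o] `&` [set o | x < Z j o].

Let mboth i j x : measurable (both i j x).
Proof. by apply: measurableI; exact: measurable_gt_set. Qed.

Let pr_both i j x : i != j -> pr P (both i j x) = G x ^+ 2.
Proof.
move=> ij.
have := ZZ ij (measurable_itv `]x, +oo[) (measurable_itv `]x, +oo[).
have mi k : measurable [set o | x < Z k o] by exact: measurable_gt_set.
rewrite !preimage_itvoy -/(both i j x) (prE P (mi i)) (prE P (mi j)) (prE P (mboth i j x)) -EFinM.
by move=> -[->]; rewrite !ZG expr2.
Qed.

(** The terms are nonnegative, so one of them above u suffices; two of them above u force two of the
    Z_n above u, since the weights are at most 1. *)
Lemma wsum_lower (N : nat) (u : R) : 0 < u ->
  \sum_(n < N) pr P (jump n u) <=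
  pr P [set o | (u%:E < wsum o)%E] + N%:R ^+ 2 * G u ^+ 2.
Proof.
move=> u0.
have H i j : (i < j < N)%N -> pr P (jump i u `&` jump j u) <= G u ^+ 2.
  move=> /andP[ij _]; rewrite -(@pr_both i j); last by rewrite neq_ltn ij.
  apply: pr_mono; [by apply: measurableI; exact: measurable_jump|exact: mboth|].
  have le n o : w n o * Z n o <= Z n o.
    by rewrite ler_piMl//; have /andP[] := w01 n o.
  by move=> o [/= h1 h2]; split => /=; [apply: lt_le_trans h1 _|apply: lt_le_trans h2 _].
apply: le_trans (bonferroni (sqr_ge0 (G u)) (measurable_jump ^~ u) H) _.
rewrite lerD2r; apply: pr_mono.
- by apply: bigsetU_measurable => i _; exact: measurable_jump.
- exact: measurable_wsum_gt.
- move=> o /(bigU_ordP (fun i => jump i u))[i _] /= h.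
  apply: (@lt_le_trans _ _ (w i o * Z i o)%:E); first by rewrite lte_fin.
  apply: (@le_trans _ _ (\sum_(0 <= n < i.+1) (w n o * Z n o)%:E)%E).
    by rewrite big_nat_recr//= leeDr// sume_ge0// => k _; rewrite lee_fin.
  by apply: nneseries_lim_ge => n _ _; rewrite lee_fin.
Qed.

(* The pairs i < j < N are enumerated as k = i N + j. *)
Lemma wsum_cover (N : nat) (u eps : R) (rho : nat -> R) : (0 < N)%N ->
  0 < u -> 0 < eps < 1 -> (forall n, 0 <= rho n) ->
  (forall M, \sum_(0 <= n < M) rho n <= 1) ->
  [set o | (u%:E < wsum o)%E] `<=`
  (\big[setU/set0]_(n < N) jump n ((1 - eps) * u)) `|`
  (\big[setU/set0]_(k < N * N) (if (k %/ N < k %% N)%N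
      then both (k %/ N) (k %% N) (eps / (2 * N%:R) * u) else set0)) `|`
  \bigcup_k jump (N + k) (eps / 2 * rho k * u).
Proof.
move=> N0 u0 /andP[eps0 eps1] rho0 rho1 o /= usum; apply: contrapT => /not_orP[/not_orP[nA nB] nC].
have N0' : 0 < N%:R :> R by rewrite ltr0n.
pose dl := eps / (2 * N%:R) * u.
have dl0 : 0 <= dl by rewrite !mulr_ge0 ?invr_ge0 ?mulr_ge0 ?ltW.
pose x n := w n o * Z n o.
have xZ n : x n <= Z n o by rewrite /x ler_piMl//; have /andP[] := w01 n o.
have hA n : (n < N)%N -> x n <= (1 - eps) * u.
  move=> nN; rewrite leNgt; apply/negP => h; apply: nA.
  by apply/(bigU_ordP (fun n => jump n ((1 - eps) * u))); exists n.
have hB i j : (i < j < N)%N -> x i <= dl \/ x j <= dl.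
  move=> /andP[ij jN].
  have [|hi] := leP (x i) dl; first by left.
  have [|hj] := leP (x j) dl; first by right.
  exfalso; apply: nB.
  apply/(bigU_ordP (fun k => if (k %/ N < k %% N)%N
      then both (k %/ N) (k %% N) (eps / (2 * N%:R) * u) else set0)).
  have jN' : (0 < N)%N by exact: leq_ltn_trans jN.
  have kd : ((i * N + j) %/ N = i)%N by rewrite divnMDl// divn_small// addn0.
  have km : ((i * N + j) %% N = j)%N by rewrite modnMDl modn_small.
  exists (i * N + j)%N => /=.
    apply: (@leq_trans (i.+1 * N)); first by rewrite mulSn addnC ltn_add2r.
    by rewrite leq_mul2r (leq_trans ij (ltnW jN)) orbT.
  rewrite kd km ij; split => /=; [exact: lt_le_trans hi (xZ i)|exact: lt_le_trans hj (xZ j)].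
have hC k : x (N + k)%N <= eps / 2 * rho k * u.
  by rewrite leNgt; apply/negP => h; apply: nC; exists k.
(* Off the cover at most one of the first N terms exceeds [dl]. That one is at most (1 - eps) u, the
   others add up to at most N dl = eps u / 2, and the later terms to at most eps u / 2 because the
   rho_k sum to at most 1. The total is then at most u. *)
have [i0 hi0] : exists i0, forall n, (n < N)%N -> n != i0 -> x n <= dl.
  have [[i [iN xi]]|no] := pselect (exists i, (i < N)%N /\ dl < x i).
    exists i => n nN ni; move: ni; rewrite neq_ltn => /orP[lt|lt].
      have [//|] := hB n i (introT andP (conj lt iN)).
      by rewrite leNgt xi.
    have [|//] := hB i n (introT andP (conj lt nN)).
    by rewrite leNgt xi.
  exists 0%N => n nN _; rewrite leNgt; apply/negP => h; apply: no; exists n; by split.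
have head : \sum_(0 <= n < N) x n <= (1 - eps) * u + eps / 2 * u.
  apply: (@le_trans _ _ (\sum_(0 <= n < N) (dl + (if n == i0 then (1 - eps) * u else 0)))).
    apply: ler_sum_nat => n /andP[_ nN]; case: eqVneq => [ni|ni].
      by rewrite (le_trans (hA _ nN))// lerDr.
    by rewrite addr0 hi0.
  rewrite big_split/= sumr_const_nat subn0 addrC lerD//.
    rewrite -big_mkcond/=.
    have [i0N|Ni0] := ltnP i0 N.
      by rewrite (big_rem i0) ?mem_index_iota//= eqxx big1_seq ?addr0// => j; rewrite mem_rem_uniq ?iota_uniq// inE => /andP[/eqP -> /andP[]]; rewrite eqxx.
    rewrite big1_seq; first by rewrite mulr_ge0 ?subr_ge0 ?ltW.
    by move=> j /andP[/eqP -> ]; rewrite mem_index_iota/= ltnNge Ni0.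
  rewrite -mulr_natl /dl le_eqVlt; apply/orP; left; apply/eqP; field.
  by rewrite gt_eqF.
have : (wsum o <= u%:E)%E.
  apply: nneseries_le_const => [n|M]; first by rewrite lee_fin.
  rewrite sumEFin lee_fin.
  have x0 n : 0 <= x n by exact: wZ0.
  apply: (@le_trans _ _ (\sum_(0 <= n < N + M) x n)).
    rewrite (@big_cat_nat _ _ _ M _ (N + M)) ?leq_addl//= lerDl.
    by apply: sumr_ge0 => n _; exact: x0.
  rewrite (@big_cat_nat _ _ _ N _ (N + M)) ?leq_addr//=.
  have -> : u = (1 - eps) * u + eps / 2 * u + eps / 2 * u by field.
  apply: lerD => //.
  rewrite -{1}[N]add0n big_addn addKn.
  apply: (@le_trans _ _ (\sum_(0 <= n < M) eps / 2 * rho n * u)).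
    by apply: ler_sum => n _; rewrite addnC.
  rewrite -mulr_suml -mulr_sumr ler_pM2r// ler_piMr// divr_ge0//.
  exact: ltW.
by rewrite leNgt usum.
Qed.

Lemma wsum_upper (N : nat) (u eps M : R) (rho : nat -> R) : (0 < N)%N ->
  0 < u -> 0 < eps < 1 -> (forall n, 0 <= rho n) ->
  (forall m, \sum_(0 <= n < m) rho n <= 1) ->
  (forall m, \sum_(0 <= k < m) pr P (jump (N + k) (eps / 2 * rho k * u)) <= M) ->
  pr P [set o | (u%:E < wsum o)%E] <=
  \sum_(n < N) pr P (jump n ((1 - eps) * u)) +
  (N * N)%:R * G (eps / (2 * N%:R) * u) ^+ 2 + M.
Proof.
move=> N0 u0 eps01 rho0 rho1 HM.
set B := fun k => if (k %/ N < k %% N)%N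
  then both (k %/ N) (k %% N) (eps / (2 * N%:R) * u) else set0.
have mB k : measurable (B k) by rewrite /B; case: ifP.
have mJ n x : measurable (jump n x) := measurable_jump n x.
have mUJ : measurable (\big[setU/set0]_(n < N) jump n ((1 - eps) * u)).
  by apply: bigsetU_measurable => i _.
have mUB : measurable (\big[setU/set0]_(k < N * N) B k).
  by apply: bigsetU_measurable => i _.
have mUC : measurable (\bigcup_k jump (N + k) (eps / 2 * rho k * u)).
  exact: bigcupT_measurable.
have mUU := measurableU _ _ mUJ mUB.
apply: (le_trans (pr_mono P (measurable_wsum_gt u) (measurableU _ _ mUU mUC)
  (wsum_cover N0 u0 eps01 rho0 rho1))).
apply: (le_trans (prU_le P mUU mUC)); apply: lerD; last first.
  rewrite -lee_fin -prE//; apply: (le_trans (le_mu_bigcup _ _ mUC)) => //.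
  apply: nneseries_le_const => [n|m]; first exact: measure_ge0.
  rewrite (eq_bigr (fun k => (pr P (jump (N + k) (eps / 2 * rho k * u)))%:E)).
    by rewrite sumEFin lee_fin.
  by move=> k _; exact: prE.
apply: (le_trans (prU_le P mUJ mUB)); apply: lerD.
  exact: (@pr_bigU_le _ _ _ P N (fun n => jump n ((1 - eps) * u))).
apply: (le_trans (pr_bigU_le P (N * N) mB)).
rewrite mulr_natl -[X in _ *+ X]card_ord -sumr_const; apply: ler_sum => k _.
rewrite /B; case: ifP => [kk|_]; last by rewrite pr0 sqr_ge0.
by rewrite pr_both// neq_ltn kk.
Qed.

(** Double jumps have probability of order u^(-2 b), and the terms of index at least N contribute at
    most K q^N u^(-b) with K free of N and u. So N is fixed before u grows, and only the single
    jumps among the first N terms survive. *)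
Lemma wsum_limit (c a q : R) : 0 <= c -> 0 < a -> 0 < q < 1 ->
  (forall n, e n = a * q ^+ n) ->
  x `^ b * G x @[x --> +oo] --> c ->
  u `^ b * pr P [set o | (u%:E < wsum o)%E] @[u --> +oo] --> c * (a / (1 - q)).
Proof.
move=> c0 a0 /andP[q0 q1] eE Glim.
have near_c k : 0 < k -> exists2 x0, 0 < x0 & forall x, x0 <= x ->
    (c - k) * x `^ (- b) <= G x <= (c + k) * x `^ (- b).
  move=> k0; have /cvgrPdist_le/(_ k k0)[A [_ HA]] := Glim.
  exists (`|A| + 1) => [|x Ax]; first by rewrite ltr_wpDl.
  have x0 : 0 < x by apply: lt_le_trans Ax; rewrite ltr_wpDl.
  have /HA : A < x by apply: lt_le_trans Ax; rewrite (le_lt_trans (ler_norm A))// ltrDl.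
  rewrite /= distrC ler_distl powRN => /andP[h1 h2].
  by rewrite ler_pdivrMr ?powR_gt0// ler_pdivlMr ?powR_gt0// [G x * _]mulrC h1 h2.
(* A bound for all x > 0 is required, because the thresholds of the late terms come arbitrarily
   close to 0. Below x1 it rests on G <= 1 <= (x1 / x)^b. *)
have [C C0 HC] : exists2 C, 0 < C & forall x, 0 < x -> G x <= C * x `^ (- b).
  have [x1 x10 Hx1] := near_c 1 ltr01.
  exists (c + 1 + x1 `^ b); first by rewrite addr_gt0 ?powR_gt0// ltr_wpDl.
  move=> x x0; have [xx1|x1x] := leP x1 x.
    have /andP[_ /le_trans] := Hx1 x xx1; apply.
    by rewrite ler_wpM2r ?powR_ge0// lerDl powR_ge0.
  apply: (le_trans (G_le1 x)); rewrite powRN ler_pdivlMr ?powR_gt0// mul1r.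
  apply: (@le_trans _ _ (x1 `^ b)).
    by rewrite ge0_ler_powR ?nnegrE ?(ltW b0) ?(ltW x0) ?(ltW x10)// ltW.
  by rewrite lerDr addr_ge0.
have q1' : 0 < 1 - q by rewrite subr_gt0.
pose A := a / (1 - q).
have A0 : 0 < A by rewrite divr_gt0.
have EN N : \sum_(n < N) e n = A * (1 - q ^+ N).
  elim: N => [|N IH]; first by rewrite big_ord0 expr0 subrr mulr0.
  by rewrite big_ord_recr/= IH eE exprS /A; field; rewrite gt_eqF.
apply/cvgrPdist_le => h h0.
(* The denominator dominates both the lower error A + c + 1 and the upper error (c + 2) A + 2; k <=
   1 absorbs the quadratic term k^2 A. *)
pose k := Num.min 1 (h / ((c + 2) * A + c + 2)).
have D0 : 0 < (c + 2) * A + c + 2 by rewrite ltr_wpDl// addr_ge0// mulr_ge0 ?addr_ge0// ltW.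
have k0 : 0 < k by rewrite lt_min ltr01 divr_gt0.
have k1 : k <= 1 by rewrite ge_min lexx.
have kh : k * ((c + 2) * A + c + 2) <= h by rewrite -ler_pdivlMr// ge_min lexx orbT.
have [x0 x00 Hx0] := near_c k k0.
have lower : exists2 u0, 0 < u0 & forall u, u0 <= u ->
    c * A - k * (A + c + 1) <= u `^ b * pr P [set o | (u%:E < wsum o)%E].
  have [N N0 HN] := @geo_small _ q A k (introT andP (conj (ltW q0) q1)) k0.
  have [u1 u10 Hu1] := @powRN_small _ b (N%:R ^+ 2 * C ^+ 2) k b0 (mulr_ge0 (sqr_ge0 _) (sqr_ge0 _)) k0.
  exists (x0 + u1) => [|u uu]; first exact: addr_gt0.
  have ux0 : x0 <= u by rewrite (le_trans _ uu)// lerDl ltW.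
  have uu1 : u1 <= u by rewrite (le_trans _ uu)// lerDr ltW.
  have u0 : 0 < u by exact: lt_le_trans ux0.
  (* [jump_ge] asks for a nonnegative constant, hence the truncation of c - k at 0. *)
  pose c' := Num.max (c - k) 0.
  have c'0 : 0 <= c' by rewrite /c' le_max lexx orbT.
  have c'c : c' <= c by rewrite /c' ge_max c0 gerBl ltW.
  have c'k : c - k <= c' by rewrite /c' le_max lexx.
  have Hj n : c' * u `^ (- b) * e n <= pr P (jump n u).
    apply: jump_ge => // z uz.
    have /andP[h1 _] := Hx0 z (le_trans ux0 uz).
    rewrite /c'; case: (leP (c - k) 0) => _; first by rewrite mul0r G_ge0.
    exact: h1.
  have ub0 : 0 < u `^ b by rewrite powR_gt0.
  have ubN : u `^ b * u `^ (- b) = 1 by rewrite powRN mulfV// gt_eqF.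
  have S : u `^ b * \sum_(n < N) pr P (jump n u) >= c' * (A * (1 - q ^+ N)).
    rewrite -EN -[leLHS]mul1r -ubN -!mulrA ler_pM2l//.
    rewrite mulrA [_ * c']mulrC mulr_sumr; apply: ler_sum => n _; exact: Hj.
  have := wsum_lower N u0; rewrite -(ler_pM2l ub0) mulrDr => W.
  have E2 : u `^ b * (N%:R ^+ 2 * G u ^+ 2) <= k.
    apply: le_trans (Hu1 u uu1).
    have : G u ^+ 2 <= (C * u `^ (- b)) ^+ 2.
      by rewrite ler_pXn2r ?nnegrE ?G_ge0 ?mulr_ge0 ?powR_ge0 ?(ltW C0)// HC.
    move=> /(ler_wpM2l (sqr_ge0 (N%:R : R))); rewrite -(ler_pM2l ub0) => /le_trans; apply.
    rewrite le_eqVlt; apply/orP; left; apply/eqP.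
    transitivity (N%:R ^+ 2 * C ^+ 2 * u `^ (- b) * (u `^ b * u `^ (- b))); first by ring.
    by rewrite ubN mulr1.
  have : c' * (A * (1 - q ^+ N)) >= c * A - k * A - k * c.
    have : c' * (A * q ^+ N) <= c * k.
      apply: ler_pM => //; first exact: (mulr_ge0 (ltW A0) (exprn_ge0 N (ltW q0))).
    have : (c - k) * A <= c' * A by rewrite ler_pM2r.
    lra.
  lra.
have upper : exists2 u0, 0 < u0 & forall u, u0 <= u ->
    u `^ b * pr P [set o | (u%:E < wsum o)%E] <= c * A + k * ((c + 2) * A + 2).
  (* Lowering the level from u to (1 - eps) u = lam u multiplies u^(-b) by lam^(-b) = 1 + k. *)
  pose lam := (1 + k) `^ (- b^-1).
  have k1p : 0 < 1 + k by rewrite addr_gt0.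
  have lam0 : 0 < lam by rewrite powR_gt0.
  have lam1 : lam < 1.
    rewrite /lam powRN invf_lt1 ?powR_gt0// -[ltLHS](one_powR b^-1).
    by rewrite gt0_ltr_powR ?invr_gt0 ?nnegrE ?(ltW k1p)// ltrDl.
  have lamE : lam `^ (- b) = 1 + k.
    by rewrite /lam -powRrM mulrNN mulVf ?gt_eqF// powRr1// ltW.
  pose eps := 1 - lam.
  have eps0 : 0 < eps by rewrite subr_gt0.
  have eps1 : eps < 1 by rewrite gtrBl.
  have epsE : 1 - eps = lam by rewrite /eps; ring.
  (* The threshold of term N + j is proportional to r^j, which costs r^(-b j) against the gain q^j.
     With r^b = q^(1/2) the ratio z = r^(-b) q equals q^(1/2), still below 1. *)
  pose r := q `^ (2 * b)^-1.
  have b20 : 0 < 2 * b by rewrite mulr_gt0.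
  have r0 : 0 < r by rewrite powR_gt0.
  have r1 : r < 1.
    by rewrite -[ltRHS](one_powR (2 * b)^-1) gt0_ltr_powR ?invr_gt0 ?nnegrE ?(ltW q0).
  have r1' : 0 < 1 - r by rewrite subr_gt0.
  pose z := r `^ (- b) * q.
  have z0 : 0 < z by rewrite mulr_gt0// powR_gt0.
  have zz : z ^+ 2 = q.
    rewrite /z exprMn -powR_mulrn ?powR_ge0// -powRrM mulNr [b * _]mulrC powRN.
    by rewrite -powRrM mulVf ?gt_eqF// powRr1 ?(ltW q0)//; field; rewrite gt_eqF.
  have z1 : z < 1.
    rewrite ltNge; apply/negP => z1; move: q1; rewrite -zz ltNge.
    by rewrite exprn_ege1.
  pose K := C * (eps / 2 * (1 - r)) `^ (- b) * a / (1 - z).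
  have [N N0 HN] := @geo_small _ q K k (introT andP (conj (ltW q0) q1)) k0.
  have N0' : 0 < N%:R :> R by rewrite ltr0n.
  pose dN := eps / (2 * N%:R).
  have dN0 : 0 < dN by rewrite divr_gt0// mulr_gt0.
  pose K2 := (N * N)%:R * (C * dN `^ (- b)) ^+ 2.
  have K20 : 0 <= K2 by rewrite mulr_ge0 ?sqr_ge0.
  have [u1 u10 Hu1] := @powRN_small _ b K2 k b0 K20 k0.
  exists (x0 / lam + u1) => [|u uu]; first by rewrite addr_gt0// divr_gt0.
  have ux0 : x0 <= lam * u.
    rewrite mulrC -ler_pdivrMr// (le_trans _ uu)// lerDl ltW//.
  have uu1 : u1 <= u by rewrite (le_trans _ uu)// lerDr ltW// divr_gt0.
  have u0 : 0 < u by exact: lt_le_trans uu1.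
  have ub0 : 0 < u `^ b by rewrite powR_gt0.
  have ubN : u `^ b * u `^ (- b) = 1 by rewrite powRN mulfV// gt_eqF.
  pose rho n := (1 - r) * r ^+ n.
  have rho0 n : 0 < rho n by rewrite mulr_gt0// exprn_gt0.
  have rho1 m : \sum_(0 <= n < m) rho n <= 1.
    by have := sum_geo_le m (ltW r1') (ltW r0) r1; rewrite divff ?gt_eqF.
  have HM m : \sum_(0 <= j < m) pr P (jump (N + j) (eps / 2 * rho j * u)) <=
      k * u `^ (- b).
    apply: (@le_trans _ _ (\sum_(0 <= j < m)
        (C * (eps / 2 * (1 - r)) `^ (- b) * u `^ (- b) * a * q ^+ N) * z ^+ j)).
      apply: ler_sum => j _.
      have t0 : 0 < eps / 2 * rho j * u by apply: mulr_gt0 => //; apply: mulr_gt0 => //; exact: divr_gt0.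
      apply: (le_trans (@jump_le (N + j) C _ t0 (ltW C0) _)).
        by move=> y ty; apply: HC; exact: lt_le_trans ty.
      rewrite eE /rho exprD /z exprMn -(powR_exprn (- b) j (ltW r0)).
      have e20 : 0 <= eps / 2 by rewrite divr_ge0// ltW.
      have -> : eps / 2 * ((1 - r) * r ^+ j) * u = eps / 2 * (1 - r) * r ^+ j * u by ring.
      rewrite (powRM _ (mulr_ge0 (mulr_ge0 e20 (ltW r1')) (exprn_ge0 j (ltW r0))) (ltW u0)).
      rewrite (powRM _ (mulr_ge0 e20 (ltW r1')) (exprn_ge0 j (ltW r0))).
      by rewrite le_eqVlt; apply/orP; left; apply/eqP; ring.
    have D0' : 0 <= C * (eps / 2 * (1 - r)) `^ (- b) * u `^ (- b) * a * q ^+ N.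
      by rewrite !mulr_ge0 ?powR_ge0 ?exprn_ge0 ?(ltW C0) ?(ltW a0) ?(ltW q0).
    apply: (le_trans (sum_geo_le m D0' (ltW z0) z1)).
    rewrite (_ : _ / _ = K * q ^+ N * u `^ (- b)); last by rewrite /K; ring.
    by rewrite ler_wpM2r ?powR_ge0.
  have := wsum_upper N0 u0 (introT andP (conj eps0 eps1)) (fun n => ltW (rho0 n)) rho1 HM.
  rewrite -(ler_pM2l ub0) epsE !(mulrDr (u `^ b)) => W; apply: (le_trans W).
  have T3 : u `^ b * (k * u `^ (- b)) = k by rewrite mulrCA ubN mulr1.
  have T2 : u `^ b * ((N * N)%:R * G (dN * u) ^+ 2) <= k.
    apply: le_trans (Hu1 u uu1).
    have : G (dN * u) ^+ 2 <= (C * (dN `^ (- b) * u `^ (- b))) ^+ 2.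
      rewrite ler_pXn2r ?nnegrE ?G_ge0 ?mulr_ge0 ?powR_ge0 ?(ltW C0)//.
      by rewrite -powRM ?(ltW dN0) ?(ltW u0)// HC// mulr_gt0.
    move=> /(ler_wpM2l (ler0n R (N * N))); rewrite -(ler_pM2l ub0) => /le_trans; apply.
    rewrite le_eqVlt; apply/orP; left; apply/eqP.
    transitivity (K2 * u `^ (- b) * (u `^ b * u `^ (- b))); first by rewrite /K2; ring.
    by rewrite ubN mulr1.
  have T1 : u `^ b * \sum_(n < N) pr P (jump n (lam * u)) <= (1 + k) * (c + k) * A.
    apply: (@le_trans _ _ (u `^ b * \sum_(n < N) ((c + k) * (lam * u) `^ (- b) * e n))).
      rewrite ler_pM2l//; apply: ler_sum => n _; apply: jump_le.
      - exact: mulr_gt0.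
      - by rewrite addr_ge0// ltW.
      - by move=> y uy; have /andP[] := Hx0 y (le_trans ux0 uy).
    rewrite -mulr_sumr EN powRM ?(ltW lam0) ?(ltW u0)// lamE.
    rewrite (_ : u `^ b * _ = (u `^ b * u `^ (- b)) * ((1 + k) * (c + k) * A * (1 - q ^+ N))); last by ring.
    rewrite ubN mul1r ler_piMr//.
      exact: (mulr_ge0 (mulr_ge0 (ltW k1p) (addr_ge0 c0 (ltW k0))) (ltW A0)).
    by rewrite gerBl exprn_ge0// ltW.
  have kk : k * k * A <= k * A by rewrite ler_pM2r// ler_piMr// ltW.
  rewrite T3; exact: wsum_upper_arith T1 T2 kk.
have [u1 u10 H1] := lower; have [u2 u20 H2] := upper.
exists (u1 + u2); split; first exact: num_real.
move=> u /ltW uu /=; rewrite distrC ler_distl -/A; apply/andP; split.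
- apply: le_trans (H1 u _); last by rewrite (le_trans _ uu)// lerDl ltW.
  have : 0 <= k * (c * A) by exact: (mulr_ge0 (ltW k0) (mulr_ge0 c0 (ltW A0))).
  have : 0 <= k * A by exact: (mulr_ge0 (ltW k0) (ltW A0)).
  lra.
- apply: (le_trans (H2 u _)); first by rewrite (le_trans _ uu)// lerDr ltW.
  have : 0 <= k * c by rewrite mulr_ge0// ltW.
  lra.
Qed.

End weighted_sum.

(** * Moments of uniform stick-breaking *)

Section uniform_moments.
Context (R : realType) (s : R).
Hypothesis s0 : 0 < s.

Local Notation mu := lebesgue_measure.

Lemma continuous_at_powR (p x : R) : 0 < x -> {for x, continuous (fun y : R => y `^ p)}.
Proof.
move=> x0; apply/differentiable_continuous/derivable1_diffP.
by have /@ex_derive := is_derive1_powR p x0.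
Qed.

Lemma powR_LRcontinuous (p : R) : 0 < p ->
  derivable_oo_LRcontinuous (fun x : R => x `^ p) 0 1.
Proof.
move=> p0; split.
- move=> x; rewrite in_itv/= => /andP[x0 _].
  by have /@ex_derive := is_derive1_powR p x0.
- by rewrite powR0 ?gt_eqF//; exact: powR_cvg0.
- by apply: cvg_at_left_filter; exact: continuous_at_powR.
Qed.

Lemma integral_powR01 : (\int[mu]_(x in `[0%R, 1%R]) (x `^ s)%:E = ((1 + s)^-1)%:E)%E.
Proof.
have s10 : 0 < 1 + s by rewrite addr_gt0.
have [dF F0 F1] := powR_LRcontinuous s10.
pose F (x : R) := (1 + s)^-1 * x `^ (1 + s).
have LRF : derivable_oo_LRcontinuous F 0 1.
  split.
  - by move=> x x01; apply: derivableM => //; exact: dF.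
  - by apply: cvgM => //; exact: cvg_cst.
  - by apply: cvgM => //; exact: cvg_cst.
have DF : {in `]0, 1[, derive1 F =1 (fun x => x `^ s)}.
  move=> x; rewrite in_itv/= => /andP[x0 _].
  rewrite derive1E; have := is_derive1_powR (1 + s) x0 => D.
  rewrite derive_val /GRing.scale/= mulrA mulVf ?gt_eqF// mul1r.
  by rewrite addrAC subrr add0r.
have cf := derivable_oo_LRcontinuous_within (powR_LRcontinuous s0).
rewrite (continuous_FTC2 (@ltr01 R) cf LRF DF) /F.
by rewrite one_powR powR0 ?gt_eqF// mulr0 mulr1 sube0.
Qed.

Lemma integral_onem_powR01 :
  (\int[mu]_(x in `[0%R, 1%R]) ((1 - x) `^ s)%:E = ((1 + s)^-1)%:E)%E.
Proof.
rewrite -integral_powR01 (@integration_by_substitution_onem R (fun x => x `^ s) 1).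
- by rewrite unstable.onem1.
- by rewrite ler01 lexx.
- exact: derivable_oo_LRcontinuous_within (powR_LRcontinuous s0).
Qed.

End uniform_moments.

Lemma bigcap_seq1 (T : Type) (E : nat -> set T) n :
  \bigcap_(i in [set` [:: n]]) E i = E n.
Proof.
apply/seteqP; split => o; first by apply; rewrite /= mem_head.
by move=> Eo i; rewrite /= inE => /eqP ->.
Qed.

Section stick_breaking.
Context (R : realType) d (T : measurableType d) (P : probability T R).
Context (V : nat -> {RV P >-> R}).
Hypothesis hV : iid_uniform01 V.

Local Notation mu := lebesgue_measure.
Local Notation L := (stick_remaining (fun n => V n : T -> R)).
Local Notation ell := (stick_length (fun n => V n : T -> R)).

Lemma measurable_stick_remaining n : measurable_fun setT (L n).
Proof.
elim: n => [|n IH] /=; first exact: measurable_cst.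
by apply: measurable_funB => //; exact: measurable_funM.
Qed.

Lemma measurable_stick_length n : measurable_fun setT (ell n).
Proof. by apply: measurable_funM => //; exact: measurable_stick_remaining. Qed.

Let indV := hV.1.

Lemma integral_uniform01 n (f : R -> R) : measurable_fun setT f -> (forall x, 0 <= f x) ->
  (\int[P]_o (f (V n o))%:E = \int[mu]_(x in `[0%R, 1%R]) (f x)%:E)%E.
Proof.
move=> mf f0.
have mf' : measurable_fun setT (EFin \o f) by exact/measurable_EFinP.
have f0' x : (0 <= (EFin \o f) x)%E by rewrite lee_fin.
transitivity (\int[distribution P (V n)]_x (EFin \o f) x)%E.
  by rewrite (ge0_integral_distribution (V n) mf' f0').
(* uniform_prob is a measure on measurableTypeR R, whose display differs from
   that of R, so that it has to be transported along the identity. *)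
pose G : measurableType _ := measurableTypeR R.
pose i : G -> R := id.
have mi : measurable_fun [set: G] i by move=> _ B mB; rewrite setTI; exact: mB.
pose m := pushforward (uniform_prob (@ltr01 R)) i.
transitivity (\int[m]_x (EFin \o f) x)%E.
  by apply: eq_measure_integral => A mA _; exact: hV.2.
rewrite (ge0_integral_pushforward mi)//.
by rewrite integral_uniform// subr0 invr1 mul1e.
Qed.

Lemma uniform01_ae n : {ae P, forall o, 0 <= V n o <= 1}.
Proof.
pose A := V n @^-1` `[0, 1].
have mA : measurable A by rewrite -[X in measurable X]setTI; exact: measurable_funPT.
have PA : P A = 1%E.
  by rewrite hV.2// /uniform_prob integral_uniform_pdf1.
exists (~` A); split.
- exact: measurableC.
- by rewrite [LHS]probability_setC// PA subee.
- by move=> o; apply: contra_not; rewrite /A/= in_itv.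
Qed.

Lemma stick_remaining01_ae n : {ae P, forall o, 0 <= L n o <= 1}.
Proof.
elim: n => [|n IH]; first by apply: aeW => o /=; rewrite ler01 lexx.
apply: filterS2 IH (uniform01_ae n) => o /= /andP[l0 l1] /andP[v0 v1].
have -> : L n o - V n o * L n o = (1 - V n o) * L n o by ring.
rewrite mulr_ge0 ?subr_ge0//= mulr_ile1 ?subr_ge0//.
by rewrite gerBl.
Qed.

Lemma stick_length01_ae n : {ae P, forall o, 0 <= ell n o <= 1}.
Proof.
apply: filterS2 (stick_remaining01_ae n) (uniform01_ae n) => o /andP[l0 l1] /andP[v0 v1].
by rewrite /stick_length mulr_ge0//= mulr_ile1.
Qed.

(** The remaining length [L n] is built from the V_i with i < n. In the induction, the hypothesis at
    n makes [L n], [V n] and an event of later V_i independent, and [L n.+1] is a function of the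
    first two. *)
Lemma stick_remaining_indep n (C : set R) (t : seq nat) (B : nat -> set R) :
  measurable C -> uniq t -> (forall i, measurable (B i)) -> all (fun i => n <= i)%N t ->
  P (L n @^-1` C `&` \bigcap_(i in [set` t]) (V i @^-1` B i)) =
  (P (L n @^-1` C) * \prod_(i <- t) P (V i @^-1` B i))%E.
Proof.
elim: n C t B => [|n IH] C t B mC ut mB nt.
  rewrite (_ : L 0 @^-1` C = if 1 \in C then setT else set0); last first.
    apply/seteqP; split => o /=; case: ifPn => //; rewrite ?inE ?notin_setE //.
  case: ifPn => _; first by rewrite setTI probability_setT mul1e (indV ut).
  by rewrite set0I measure0 mul0e.
have [X XE] := mfun_of_measurable (measurable_stick_remaining n).
pose D := \bigcap_(i in [set` t]) (V i @^-1` B i).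
have mD : measurable D.
  by apply: fin_bigcap_measurable => // i _; rewrite -[X in measurable X]setTI; exact: measurable_funPT.
have nnt : n \notin t.
  by apply/negP => /(allP nt); rewrite ltnn.
have PD : P D = (\prod_(i <- t) P (V i @^-1` B i))%E by exact: indV.
have cond E F : measurable E -> measurable F ->
    P (X @^-1` E `&` V n @^-1` F `&` D) = (P (X @^-1` E) * P (V n @^-1` F) * P D)%E.
  move=> mE mF.
  have := IH E (n :: t) (fun i => if i == n then F else B i) mE.
  rewrite /= nnt ut leqnn => /(_ isT).
  have mFB i : measurable (if i == n then F else B i) by case: ifP.
  move=> /(_ mFB).
  have -> : all (fun i => n <= i)%N t by apply: sub_all nt => i; exact: ltnW.
  move=> /(_ isT); rewrite big_cons eqxx.
  rewrite (eq_big_seq (fun i => P (V i @^-1` B i))); last first.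
    by move=> i it; case: eqP => // ie; move: nnt; rewrite -ie it.
  rewrite -PD XE muleA => <-; congr (P _); rewrite -setIA; congr (_ `&` _).
  apply/seteqP; split => o /=.
    move=> [Fo Do] i /=; rewrite inE => /predU1P[->|it]; first by rewrite eqxx.
    by case: eqP => [->//|_]; exact: Do.
  move=> H; split.
    by have /= := H n; rewrite inE eqxx; exact.
  move=> i /= it; have /= := H i; rewrite inE it orbT => /(_ isT).
  by case: eqP => // ie; move: nnt; rewrite -ie it.
have XV : indep2 P X (V n).
  move=> E F mE mF.
  have := IH E [:: n] (fun=> F) mE isT (fun=> mF).
  by rewrite /= leqnn big_seq1 bigcap_seq1 XE => /(_ isT).
pose A := [set p : R * R | C (p.1 - p.2 * p.1)].
have mA : measurable A.
  have mf : measurable_fun setT (fun p : R * R => p.1 - p.2 * p.1).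
    by apply: measurable_funB => //; exact: measurable_funM.
  by rewrite -[X in measurable X]setTI; exact: mf.
have := joint_law_indep XV mD cond mA.
by rewrite -PD /A XE /=.
Qed.

Lemma stick_indep n : indep2 P (V n) (L n).
Proof.
move=> B C mB mC.
have := @stick_remaining_indep n C [:: n] (fun=> B) mC isT (fun=> mB).
by rewrite /= leqnn big_seq1 bigcap_seq1 muleC setIC => /(_ isT).
Qed.

Section powers.
Variable s : R.
Hypothesis s0 : 0 < s.
Let q := (1 + s)^-1.

Lemma stick_remaining_power n : (\int[P]_o (L n o `^ s)%:E = (q ^+ n)%:E)%E.
Proof.
elim: n => [|n IH] /=.
  under eq_integral do rewrite one_powR.
  by rewrite integral_cst//= mul1e probability_setT expr0.
have [X XE] := mfun_of_measurable (measurable_stick_remaining n).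
have XV : indep2 P (V n) X by rewrite XE; exact: stick_indep.
have mpow : measurable_fun setT (fun x : R => x `^ s) by exact: measurable_powR.
have mpow1 : measurable_fun setT (fun x : R => (1 - x) `^ s).
  by apply: measurableT_comp mpow _; exact: measurable_funB.
(* The power of (1 - V n) L n splits into a product where both factors are nonnegative, which is
   known almost surely. *)
transitivity (\int[P]_o ((1 - V n o) `^ s * X o `^ s)%:E)%E.
  apply: ge0_ae_eq_integral => //.
  - apply/measurable_EFinP; apply: measurableT_comp mpow _.
    exact: (measurable_stick_remaining n.+1).
  - apply/measurable_EFinP; apply: measurable_funM.
      exact: measurableT_comp mpow1 (measurable_funPT (V n)).
    exact: measurableT_comp mpow (measurable_funPT X).
  - by move=> o _; rewrite lee_fin powR_ge0.
  - by move=> o _; rewrite lee_fin mulr_ge0 ?powR_ge0.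
  - apply: filterS2 (stick_remaining01_ae n) (uniform01_ae n) => o /andP[l0 l1] /andP[v0 v1] _.
    rewrite XE -powRM ?subr_ge0//; congr (_ `^ _)%:E; ring.
have ge0 x : 0 <= (fun x : R => x `^ s) x by exact: powR_ge0.
have ge0' x : 0 <= (fun x : R => (1 - x) `^ s) x by exact: powR_ge0.
rewrite (indep2_expectation_mul XV mpow1 mpow ge0' ge0).
rewrite (integral_uniform01 n mpow1 ge0') integral_onem_powR01// XE IH.
by rewrite -EFinM exprS.
Qed.

(** [ell n] is the stick of number n + 1, hence n + 1 factors q; the shape a q^n is the one required
    of the moments of the weights. *)
Lemma stick_length_power n : (\int[P]_o (ell n o `^ s)%:E = (q * q ^+ n)%:E)%E.
Proof.
have [X XE] := mfun_of_measurable (measurable_stick_remaining n).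
have XV : indep2 P (V n) X by rewrite XE; exact: stick_indep.
have mpow : measurable_fun setT (fun x : R => x `^ s) by exact: measurable_powR.
transitivity (\int[P]_o (V n o `^ s * X o `^ s)%:E)%E.
  apply: ge0_ae_eq_integral => //.
  - by apply/measurable_EFinP; apply: measurableT_comp mpow (measurable_stick_length n).
  - apply/measurable_EFinP; apply: measurable_funM.
      exact: measurableT_comp mpow (measurable_funPT (V n)).
    exact: measurableT_comp mpow (measurable_funPT X).
  - by move=> o _; rewrite lee_fin powR_ge0.
  - by move=> o _; rewrite lee_fin mulr_ge0 ?powR_ge0.
  - apply: filterS2 (stick_remaining01_ae n) (uniform01_ae n) => o /andP[l0 l1] /andP[v0 v1] _.
    by rewrite XE /stick_length powRM.
have ge0 x : 0 <= (fun x : R => x `^ s) x by exact: powR_ge0.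
rewrite (indep2_expectation_mul XV mpow mpow ge0 ge0).
by rewrite (integral_uniform01 n mpow ge0) integral_powR01// XE stick_remaining_power.
Qed.

End powers.

End stick_breaking.

(** * Limits at infinity and conclusion *)

Section limits_at_infinity.
Context (R : realType).

Lemma cvg_infty_of_ge (g : R -> R) :
  (forall A, exists B, forall x, B <= x -> A <= g x) -> g x @[x --> +oo] --> +oo.
Proof.
move=> H; apply/cvgryPge => A; have [B HB] := H A.
by exists B; split => [|x /ltW]; [exact: num_real|exact: HB].
Qed.

Lemma sqrt_infty : Num.sqrt x @[x --> +oo] --> (+oo : set_system R).
Proof.
apply: cvg_infty_of_ge => A; exists (A ^+ 2) => x Ax.
by rewrite (le_trans (ler_norm A))// -sqrtr_sqr ler_wsqrtr.
Qed.

Lemma cvg_gt_eq (A : R) (f g : R -> R) (l : R) :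
  (forall x, A < x -> f x = g x) -> f x @[x --> +oo] --> l -> g x @[x --> +oo] --> l.
Proof.
move=> fg; apply: cvg_trans; apply: near_eq_cvg.
by exists A; split => [|x x0]; [exact: num_real|exact: fg].
Qed.

Lemma cvg_infty_eq (f g : R -> R) (l : R) :
  (forall x, 0 < x -> f x = g x) -> f x @[x --> +oo] --> l -> g x @[x --> +oo] --> l.
Proof. exact: cvg_gt_eq. Qed.

(** Since x^alpha and (x - b)^alpha are asymptotically equal, undoing the centering leaves the tail
    constants unchanged. *)
Lemma tail_shift (G : R -> R) (alpha b c : R) :
  x `^ alpha * G x @[x --> +oo] --> c ->
  x `^ alpha * G (x - b) @[x --> +oo] --> c.
Proof.
move=> Gc.
have shift : x - b @[x --> +oo] --> (+oo : set_system R).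
  by apply: cvg_infty_of_ge => A; exists (A + b) => x; rewrite lerBrDr.
have inv0 : (x - b)^-1 @[x --> +oo] --> (0 : R).
  apply/gtr0_cvgV0; last exact: shift.
  by exists b; split => [|x bx]; [exact: num_real|rewrite subr_gt0].
have ratio : 1 + b * (x - b)^-1 @[x --> +oo] --> (1 : R).
  rewrite -[X in _ --> X]addr0 -[X in _ --> _ + X](mulr0 b).
  by apply: cvgD; [exact: cvg_cst|apply: cvgM => //; exact: cvg_cst].
have rpow : (1 + b * (x - b)^-1) `^ alpha @[x --> +oo] --> (1 : R).
  rewrite -[X in _ --> X](one_powR alpha).
  exact: (cvg_comp _ _ ratio (@continuous_at_powR R alpha 1 ltr01)).
have := cvgM rpow (cvg_comp _ _ shift Gc) => /(_ _); rewrite mul1r.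
apply: (@cvg_gt_eq (Num.max b 0)) => x; rewrite gt_max => /andP[bx x0] /=.
have xb : 0 < x - b by rewrite subr_gt0.
rewrite mulrA -powRM ?(ltW xb)//.
  by congr (_ `^ _ * _); field; rewrite gt_eqF.
have -> : 1 + b / (x - b) = x / (x - b) by field; rewrite gt_eqF.
by rewrite divr_ge0 ?ltW.
Qed.

Lemma sqrt_powR (x alpha : R) : 0 < x -> Num.sqrt x `^ alpha = x `^ (alpha / 2).
Proof. by move=> x0; rewrite -powR12_sqrt ?ltW// -powRrM mulrC. Qed.

Lemma tail_sqrt (G : R -> R) (alpha c : R) :
  x `^ alpha * G x @[x --> +oo] --> c ->
  x `^ (alpha / 2) * G (Num.sqrt x) @[x --> +oo] --> c.
Proof.
move=> Gc; apply: cvg_infty_eq (cvg_comp _ _ sqrt_infty Gc) => x x0 /=.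
by rewrite sqrt_powR.
Qed.

Lemma half_lt (x : R) (S : \bar R) :
  (x%:E < (2^-1)%:E * S)%E = ((2 * x)%:E < S)%E.
Proof.
case: S => [r| |].
- by rewrite -EFinM !lte_fin -ltr_pdivrMl// invrK.
- by rewrite gt0_muley ?lte_fin// !ltry.
- by rewrite gt0_muleNy ?lte_fin// !ltNge !leNye.
Qed.

Lemma pr_ae_eq d (T : measurableType d) (P : probability T R) (A B : set T) :
  measurable A -> measurable B -> {ae P, forall w, A w <-> B w} -> pr P A = pr P B.
Proof.
move=> mA mB [N [mN PN ABN]].
have sub C D : measurable C -> measurable D ->
    (forall w, ~ N w -> C w -> D w) -> pr P C <= pr P D.
  move=> mC mD CD.
  apply: (@le_trans _ _ (pr P (D `|` N))).
    apply: pr_mono => //; first exact: measurableU.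
    by move=> w Cw; have [Nw|nN] := pselect (N w); [right|left; exact: CD].
  by apply: (le_trans (prU_le P mD mN)); rewrite {2}/pr PN addr0.
have AB w : ~ N w -> (A w <-> B w).
  by move=> nN; apply: contrapT => h; apply: nN; exact: ABN.
by apply/eqP; rewrite eq_le !sub// => w /AB[].
Qed.

End limits_at_infinity.

(** The tails of Y are those of W_1 + b by equality of laws, even though Y lives on another space;
    the right tail is shifted by b and the left one by -b. *)
Lemma stable_tails (R : realType) (alpha : R) d (T : measurableType d)
    (P : probability T R) (S : R -> {RV P >-> R})
    d' (T' : measurableType d') (P' : probability T' R) (Y : {RV P' >-> R}) :
  1 < alpha < 2 -> stable_process alpha S -> same_law P' Y P (S 1) ->
  exists cp cm : R, [/\ 0 <= cp, 0 <= cm, 0 < cp + cm,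
    x `^ alpha * pr P' [set w | x < Y w] @[x --> +oo] --> cp &
    x `^ alpha * pr P' [set w | x < - Y w] @[x --> +oo] --> cm].
Proof.
move=> halpha hS YS.
have [b [W [hW nd W1]]] := stable_walk_of_process halpha hS.
have [cp [cm [cp0 cm0 cc hp hm]]] := walk_tails halpha hW nd.
exists cp, cm; split => //.
- apply: cvg_infty_eq (tail_shift b hp) => x _; congr (_ * _).
  rewrite /tailp /pr.
  have -> : [set w | x < Y w] = Y @^-1` `]x, +oo[.
    by apply/seteqP; split => w /=; rewrite in_itv/= andbT.
  rewrite YS// -W1//; congr (fine (P _)).
  by apply/seteqP; split => w /=; rewrite in_itv/= andbT ltrBlDr.
- apply: cvg_infty_eq (tail_shift (- b) hm) => x _; congr (_ * _).
  rewrite /tailp /pr.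
  have -> : [set w | x < - Y w] = Y @^-1` `]-oo, (- x)[.
    by apply/seteqP; split => w /=; rewrite in_itv/= ltrNr.
  rewrite YS// -W1//; congr (fine (P _)).
  by apply/seteqP; split => w /=; rewrite in_itv/= opprK => ?; lra.
Qed.

Theorem proposition1p5 (R : realType) (alpha : R)
  (halpha : 1 < alpha < 2)
  (dS : measure_display) (TS : measurableType dS) (PS : probability TS R)
  (S : R -> {RV PS >-> R})
  (hS : stable_process alpha S)
  (dX : measure_display) (TX : measurableType dX) (PX : probability TX R)
  (X : R -> {RV PX >-> R})
  (hX : levy_process X)
  (hX1 : PX.-integrable [set: TX] (EFin \o X 1))
  (hEX1 : ('E_PX[X 1%R] = 0)%E)
  (a l : R -> R)
  (ha0 : forall t, 0 < t -> 0 < a t)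
  (ha : forall t, 0 < t -> a t = t `^ alpha^-1 * l t)
  (hl : slowly_varying l)
  (hXS : cvg_in_distribution +oo PX (fun t w => X t w / a t) PS (S 1))
  (d : measure_display) (T : measurableType d) (P : probability T R)
  (V Sn : nat -> {RV P >-> R})
  (hV : iid_uniform01 V)
  (hSn_indep : mutually_independent P (fun n => Sn n : T -> R))
  (hSn_law : forall n, same_law P (Sn n) PS (S 1))
  (hVSn : independent_families P (stick_length (fun n => V n : T -> R))
            (fun n => Sn n : T -> R)) :
  let ell := stick_length (fun n => V n : T -> R) in
  let tail (x : R) : R :=
    fine (P [set w | (x%:E < (2^-1)%:E *
      \sum_(0 <= n <oo) (ell n w `^ (2 / alpha - 1) * Sn n w ^+ 2)%:E)%E]) in
  exists cp cm : R,
    [/\ 0 <= cp, 0 <= cm, 0 < cp + cm,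
        fine (P [set w | Num.sqrt x < Sn 0%N w]) / x `^ (- (alpha / 2))
          @[x --> +oo] --> cp &
        fine (P [set w | Num.sqrt x < - Sn 0%N w]) / x `^ (- (alpha / 2))
          @[x --> +oo] --> cm] /\
    (tail x / fine (P [set w | x < Sn 0%N w ^+ 2])
       @[x --> +oo] --> 2 `^ (1 - alpha / 2) / (2 - alpha)) /\
    (tail x / ((cp + cm) * x `^ (- (alpha / 2)))
       @[x --> +oo] --> 2 `^ (1 - alpha / 2) / (2 - alpha)).
Proof.
move=> ell tail; have /andP[a1 a2] := halpha.
have alpha0 : 0 < alpha by exact: lt_trans a1.
have [cp [cm [cp0 cm0 cc hp hm]]] := stable_tails halpha hS (hSn_law 0%N).
exists cp, cm.
have b0 : 0 < alpha / 2 by rewrite divr_gt0.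
have hp2 := tail_sqrt hp; have hm2 := tail_sqrt hm.
have divN (y x : R) : y / x `^ (- (alpha / 2)) = x `^ (alpha / 2) * y.
  by rewrite powRN invrK mulrC.
split.
  by split => //; [move: hp2|move: hm2]; apply: cvg_infty_eq => x _; rewrite divN.
pose sq (x : R) := x ^+ 2.
have msq : measurable_fun setT sq by exact: measurable_funX.
pose Z n : {mfun T >-> R} := mfun_Sub (mem_set (measurableT_comp msq (measurable_funPT (Sn n)))).
pose gam := 2 / alpha - 1.
have gam0 : 0 < gam by rewrite subr_gt0 ltr_pdivlMr// mul1r.
(* Stick lengths lie in [0, 1] only almost surely, whereas the weights must do so everywhere. The
   truncation at 1 changes them on a null set. *)
pose cl (x : R) := Num.min 1 (x `^ gam).
have mcl : measurable_fun setT cl by apply: measurable_minr => //; exact: measurable_powR.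
pose w n : {mfun T >-> R} := mfun_Sub (mem_set (measurableT_comp mcl (measurable_stick_length V n))).
pose G x := pr P [set o | x < Z 0%N o].
pose s := 1 - alpha / 2.
have s0 : 0 < s by rewrite subr_gt0 ltr_pdivrMr// mul1r.
pose q := (1 + s)^-1.
have Z0 n o : 0 <= Z n o by exact: sqr_ge0.
have w01 n o : 0 <= w n o <= 1.
  by rewrite /= /cl le_min ler01 powR_ge0/= ge_min lexx.
have ellS n : indep2 P (ell n) (Sn n).
  move=> B C mB mC.
  by have := hVSn [:: n] [:: n] (fun=> B) (fun=> C) (fun=> mB) (fun=> mC); rewrite /= !bigcap_seq1.
have wZ n : indep2 P (w n) (Z n) by exact: (indep2_comp mcl msq (ellS n)).
have ZZ i j : i != j -> indep2 P (Z i) (Z j).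
  by move=> ij; exact: (indep2_comp msq msq (mutually_independent2 hSn_indep ij)).
have ZG n x : pr P [set o | x < Z n o] = G x.
  rewrite /G /pr.
  have E k : [set o | x < Z k o] = Sn k @^-1` (sq @^-1` `]x, +oo[).
    by apply/seteqP; split => o /=; rewrite in_itv/= andbT.
  have mB : measurable (sq @^-1` `]x, +oo[).
    by have := msq measurableT _ (measurable_itv `]x, +oo[); rewrite setTI.
  by rewrite !E !hSn_law.
have we n : (\int[P]_o (w n o `^ (alpha / 2))%:E = (q * q ^+ n)%:E)%E.
  rewrite -(stick_length_power hV s0 n); apply: ge0_ae_eq_integral => //.
  - apply/measurable_EFinP.
    exact: measurableT_comp (measurable_powR _) (measurable_funPT (w n)).
  - by apply/measurable_EFinP; exact: measurableT_comp (measurable_powR s) (measurable_stick_length V n).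
  - by move=> o _; rewrite lee_fin powR_ge0.
  - by move=> o _; rewrite lee_fin powR_ge0.
  - apply: filterS (stick_length01_ae hV n) => o /andP[l0 l1] _; congr EFin.
    rewrite /= /cl min_r; last first.
      by rewrite -(one_powR gam) ge0_ler_powR ?nnegrE ?(ltW gam0).
    (* The exponents multiply to (2 / alpha - 1) (alpha / 2) = 1 - alpha / 2 = s. *)
    rewrite -powRrM; congr (_ `^ _); rewrite /gam /s; field; rewrite gt_eqF//.
have s10 : 0 < 1 + s by rewrite addr_gt0.
have q01 : 0 < q < 1.
  by rewrite /q invr_gt0 s10/= invf_lt1// ltrDl.
have Glim : x `^ (alpha / 2) * G x @[x --> +oo] --> cp + cm.
  have := cvgD hp2 hm2 => /(_ _); apply: cvg_infty_eq => x x0 /=.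
  rewrite -mulrDr -prU_disj; first last.
  - apply/seteqP; split => o //= [h1 h2].
    have := sqrtr_ge0 x; lra.
  - by apply: measurable_gt_set; exact: measurableT_comp.
  - exact: measurable_gt_set.
  have E y : (x < y ^+ 2) = (Num.sqrt x < y) || (Num.sqrt x < - y).
    rewrite -ltr_normr -(real_normK (num_real y)) -[in LHS](sqr_sqrtr (ltW x0)).
    by rewrite ltr_pXn2r ?nnegrE ?sqrtr_ge0.
  congr (_ * pr P _); apply/seteqP; split => o /=.
    by move=> h; rewrite /sq E; apply/orP.
  by rewrite /sq E => /orP.
have lim := wsum_limit b0 Z0 w01 wZ ZZ ZG we (addr_ge0 cp0 cm0) (andP q01).1 q01 (fun=> erefl) Glim.
have tailE x : tail x = pr P [set o | ((2 * x)%:E < wsum Z w o)%E].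
  pose u n o := ell n o `^ gam * Sn n o ^+ 2.
  have mu n : measurable_fun setT (u n).
    apply: measurable_funM; first exact: measurableT_comp (measurable_powR gam) (measurable_stick_length V n).
    exact: measurable_funX.
  have mU : measurable [set o | ((2 * x)%:E < \sum_(0 <= n <oo) (u n o)%:E)%E].
    rewrite -[X in measurable X]setTI; apply: emeasurable_fun_o_infty => //.
    apply: ge0_emeasurable_sum => k *; first by rewrite lee_fin mulr_ge0 ?powR_ge0 ?sqr_ge0.
    exact/measurable_EFinP.
  have -> : tail x = pr P [set o | ((2 * x)%:E < \sum_(0 <= n <oo) (u n o)%:E)%E].
    rewrite /tail /pr; congr (fine (P _)).
    by apply/seteqP; split => o /=; rewrite half_lt.
  apply: pr_ae_eq => //; first exact: measurable_wsum_gt.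
  apply: filterS (ae_foralln (stick_length01_ae hV)) => o ell01.
  rewrite /= /wsum (_ : (fun m => _) = (fun m => (\sum_(0 <= n < m) (w n o * Z n o)%:E)%E))//.
  apply/funext => m; apply: eq_bigr => n _; congr EFin; congr (_ * _).
  have /andP[l0 l1] := ell01 n.
  by rewrite /= /cl min_r// -(one_powR gam) ge0_ler_powR ?nnegrE ?(ltW gam0).
have A : q / (1 - q) = s^-1.
  by rewrite /q; field; rewrite !gt_eqF// addr_gt0.
pose K := 2 `^ (1 - alpha / 2) / (2 - alpha) : R.
(* The factor 1/2 before the sum turns the level x into 2 x, whence 2^(-alpha/2); the other factor 2
   comes from 1 / s = 2 / (2 - alpha). *)
have KE : K = 2 `^ (- (alpha / 2)) * s^-1.
  rewrite /K powRD ?pnatr_eq0 ?implybT// powRr1// /s.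
  by field; rewrite !gt_eqF// subr_gt0.
have tlim : x `^ (alpha / 2) * tail x @[x --> +oo] --> (cp + cm) * K.
  have dbl : 2 * x @[x --> +oo] --> (+oo : set_system R).
    by apply: cvg_infty_of_ge => B; exists (B / 2) => x; rewrite ler_pdivrMr// mulrC.
  have : 2 `^ (- (alpha / 2)) * ((2 * x) `^ (alpha / 2) *
      pr P [set o | ((2 * x)%:E < wsum Z w o)%E]) @[x --> +oo] -->
      2 `^ (- (alpha / 2)) * ((cp + cm) * (q / (1 - q))).
    by apply: cvgM; [exact: cvg_cst|exact: (cvg_comp _ _ dbl lim)].
  have -> : 2 `^ (- (alpha / 2)) * ((cp + cm) * (q / (1 - q))) = (cp + cm) * K.
    by rewrite KE A; ring.
  apply: cvg_infty_eq => x x0 /=; rewrite tailE powRM ?(ltW x0)// !mulrA.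
  by rewrite powRN mulVf ?mul1r// gt_eqF// powR_gt0.
have cn0 : cp + cm != 0 by rewrite gt_eqF.
split.
- have : (x `^ (alpha / 2) * tail x) * (x `^ (alpha / 2) * G x)^-1 @[x --> +oo] -->
      (cp + cm) * K * (cp + cm)^-1 by apply: cvgM => //; exact: cvgV.
  rewrite mulrAC mulfV// mul1r.
  apply: cvg_infty_eq => x x0 /=.
  by rewrite invfM mulrACA mulfV ?mul1r// gt_eqF// powR_gt0.
- have : (x `^ (alpha / 2) * tail x) * (cp + cm)^-1 @[x --> +oo] -->
      (cp + cm) * K * (cp + cm)^-1 by apply: cvgM => //; exact: cvg_cst.
  rewrite mulrAC mulfV// mul1r.
  apply: cvg_infty_eq => x x0 /=.
  by rewrite invfM powRN invrK; ring.
Qed.
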